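(* Pointers in the game semantics of safe $\lambda$-terms are only necessary from order 4 onwards. Precisely: (a) if $x_1:A_1,\ldots,x_p:A_p\vdash_{\sf s}M:T$ is safe and $\mathrm{ord}(A_1,\ldots,A_p,T)\le3$, then each play in $[\![x_1:A_1,\ldots,x_p:A_p\vdash M:T]\!]$ is uniquely determined among the plays of that strategy by its underlying sequence of moves (all justification pointers, from P-moves and O-moves alike, are uniquely recoverable). (b) This fails at order 4: for a constant $a:o$, the term-in-context $\psi:(((o,o),o),o)\vdash_{\sf s}\psi(\lambda\varphi^{(o,o)}.\varphi\,a):o$ is safe, and its denotation contains two distinct plays with the same underlying sequence of moves $q_0\,q_1\,q_2\,q_3\,q_2\,q_3\,q_4$, in which the O-move $q_4$ points respectively to the first and to the second occurrence of $q_3$. Here $q_0,q_1,q_2,q_3,q_4$ are the questions of the arena of $(((o^4,o^3),o^2),o^1)\to o^0$, $q_i$ corresponding to the occurrence $o^i$ of $o$.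
   Context: Simple types are generated by $A ::= o \mid A \to A$ ($\to$ associates to the right); $(A_1,\ldots,A_n,B)$ abbreviates $A_1\to\cdots\to A_n\to B$. Orders: $\mathrm{ord}(o)=0$, $\mathrm{ord}(A\to B)=\max(\mathrm{ord}(A)+1,\mathrm{ord}(B))$. Terms are Church-style simply-typed terms built from typed variables (without constants, except for the ground-type constant $a$ in part (b), which denotes a fixed value of $\mathcal D$ below). The order of a term or symbol is the order of its type. Safe lambda calculus. Judgements $\Gamma\vdash_{\sf s} M:A$ and $\Gamma\vdash_{\sf asa} M:A$ are defined by mutual induction. ''$c\le \mathrm{ord}\,\Gamma$'' means $c\le \mathrm{ord}(y)$ for every $y\in\Gamma$. (var) $x:A\vdash_{\sf s}x:A$. (const) $\vdash_{\sf s}f:A$ for each constant $f:A$. (wk) from $\Gamma\vdash_{\sf s}M:A$ infer $\Delta\vdash_{\sf s}M:A$ if $\Gamma\subset\Delta$. ($\delta$) from $\Gamma\vdash_{\sf s}M:A$ infer $\Gamma\vdash_{\sf asa}M:A$. (app$_{as}$) from $\Gamma\vdash_{\sf asa}M:A\to B$ and $\Gamma\vdash_{\sf s}N:A$ infer $\Gamma\vdash_{\sf asa}MN:B$. (app) from $\Gamma\vdash_{\sf asa}M:A\to B$ and $\Gamma\vdash_{\sf s}N:A$ infer $\Gamma\vdash_{\sf s}MN:B$, provided $\mathrm{ord}(B)\le\mathrm{ord}\,\Gamma$. (abs) from $\Gamma,x_1:A_1,\ldots,x_n:A_n\vdash_{\sf asa}M:B$ infer $\Gamma\vdash_{\sf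 s}\lambda x_1^{A_1}\ldots x_n^{A_n}.M:(A_1,\ldots,A_n,B)$, provided $\mathrm{ord}(A_1,\ldots,A_n,B)\le\mathrm{ord}\,\Gamma$. Game semantics (standard Hyland–Ong well-bracketed innocent game model). Fix a nonempty set $\mathcal D$ of values of type $o$. The arena of $o$ has one initial O-question enabling an answer $v$ for each $v\in\mathcal D$; the arena of $(A_1,\ldots,A_n,o)$ has one initial O-question $q$, enabling answers $v\in\mathcal D$ and the initial moves of copies of the arenas of $A_1,\ldots,A_n$ with O/P polarity reversed. $[\![x_1:A_1,\ldots,x_p:A_p\vdash M:T]\!]$ is the usual innocent strategy denoting $M$, on the arena of $(A_1,\ldots,A_p,T)$. A justified sequence is an alternating sequence of O- and P-moves, where each move except the opening (initial) one has a pointer to an earlier occurrence of a move enabling it; a play is a justified sequence satisfying (P- and O-) Visibility and Well-Bracketing; a strategy is a prefix-closed set of plays. *)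

(* Defs.v *)
From HB Require Import structures.
From mathcomp Require Import all_boot.
Set Implicit Arguments.
Unset Strict Implicit.
Unset Printing Implicit Defensive.

(** * Simple types and terms *)

Inductive ty : Type := Base | Arr of ty & ty.

Fixpoint ty_eqb (A B : ty) : bool :=
  match A, B with
  | Base, Base => true
  | Arr A1 A2, Arr B1 B2 => ty_eqb A1 B1 && ty_eqb A2 B2
  | _, _ => false
  end.

Lemma ty_eqbP : Equality.axiom ty_eqb.
Proof.
move=> A B; apply: (iffP idP) => [|<-]; last by elim: A => //= ? -> ? ->.
elim: A B => [|A1 IH1 A2 IH2] [|B1 B2] //= /andP[/IH1-> /IH2->] //.
Qed.

HB.instance Definition _ := hasDecEq.Build ty ty_eqbP.

Fixpoint ord (A : ty) : nat :=
  if A is Arr A1 A2 then maxn (ord A1).+1 (ord A2) else 0.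

(* args (A_1 -> ... -> A_n -> o) = [:: A_1; ...; A_n] *)
Fixpoint args (A : ty) : seq ty :=
  if A is Arr A1 A2 then A1 :: args A2 else [::].

(* Variables are named by natural numbers; C is the type of ground constants. *)
Inductive term (C : Type) : Type :=
| Var of nat
| Con of C
| App of term C & term C
| Lam of nat & ty & term C.
Arguments Var {C}.

Definition ctx := seq (nat * ty).

Definition lams C (xs : ctx) (M : term C) : term C :=
  foldr (fun x N => Lam x.1 x.2 N) M xs.

(* closeT [:: (x_1, A_1); ...; (x_p, A_p)] T is the type (A_1, ..., A_p, T). *)
Definition closeT (G : ctx) (T : ty) : ty := foldr (fun x B => Arr x.2 B) T G.

(** * The safe lambda calculus *)

Definition ord_le_ctx (c : nat) (G : ctx) : bool := all (fun y => c <= ord y.2) G.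

(* Contexts are sets of typed variables with distinct names.  They are
   represented by lists, which [safe_wk] allows to be reordered freely. *)
Definition wf_ctx (G : ctx) : bool := uniq (unzip1 G).

Inductive safe (C : Type) : ctx -> term C -> ty -> Prop :=
| safe_var x A : safe [:: (x, A)] (Var x) A
| safe_const c : safe [::] (Con c) Base
| safe_wk G D M A :
    safe G M A -> {subset G <= D} -> wf_ctx D -> safe D M A
| safe_app G M N A B :
    asafe G M (Arr A B) -> safe G N A -> ord_le_ctx (ord B) G ->
    safe G (App M N) B
| safe_abs G xs M B :
    0 < size xs -> asafe (G ++ xs) M B ->
    ord_le_ctx (ord (closeT xs B)) G ->
    safe G (lams xs M) (closeT xs B)
with asafe (C : Type) : ctx -> term C -> ty -> Prop :=
| asafe_delta G M A : safe G M A -> asafe G M A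
| asafe_app G M N A B :
    asafe G M (Arr A B) -> safe G N A -> asafe G (App M N) B.

(** * Arenas

   The arena of a type is a tree, so that a move is
   identified by an address.  The address [:: i_1; ...; i_k] stands for the root
   of the copy of the arena of the i_k-th argument of the ... of the i_1-th
   argument of the type (counting from 0).  The move (r, None) is the question
   at address r, and (r, Some v) is the answer v to that question. *)

Definition move (D : Type) : Type := (seq nat * option D)%type.

Fixpoint subty (A : ty) (r : seq nat) : option ty :=
  if r is i :: r' then
    if onth (args A) i is Some B then subty B r' else None
  else Some A.

Definition initial D (m : move D) : Prop := m = ([::], None).

(* m enables m' in the arena of A *)
Definition enables D (A : ty) (m m' : move D) : Prop :=
  [/\ m.2 = None, subty A m'.1 <> None &
      (exists i, m' = (rcons m.1 i, None)) \/ (exists v, m' = (m.1, Some v))].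

Definition is_question D (m : move D) : bool := ~~ isSome m.2.

Definition is_P D (m : move D) : bool := odd (size m.1) (+) isSome m.2.

(** * Justified sequences and plays *)

(* Sequences of occurrences; each one carries the position it points to. *)
Definition jseq (X : Type) : Type := seq (X * option nat).

Definition moves X (s : jseq X) : seq X := unzip1 s.

Definition mv X (s : jseq X) (i : nat) : option X := omap fst (onth s i).

Definition ptr X (s : jseq X) (i : nat) : option nat := obind snd (onth s i).

Definition holds X (P : X -> bool) (s : jseq X) (i : nat) : bool :=
  oapp P false (mv s i).

Definition justified X (ini : X -> Prop) (en : X -> X -> Prop) (s : jseq X) :=
  forall i m p, onth s i = Some (m, p) ->
    if i is 0 then ini m /\ p = None
    else exists k m', [/\ p = Some k, k < i, mv s k = Some m' & en m' m].

Section Plays.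
Variable D : Type.
Implicit Type s : jseq (move D).

Definition alternating s : Prop :=
  forall i m, mv s i = Some m -> is_P m = odd i.

(* [view pl s n k]: position k belongs to the view of the prefix of s of length
   n, where the view is the P-view if pl is true and the O-view otherwise. *)
Inductive view (pl : bool) s : nat -> nat -> Prop :=
| view_last n : n < size s -> view pl s n.+1 n
| view_own n m k :
    mv s n = Some m -> is_P m = pl -> view pl s n k -> view pl s n.+1 k
| view_just n m j :
    mv s n = Some m -> is_P m = ~~ pl -> ptr s n = Some j -> view pl s n.+1 j
| view_other n m j k :
    mv s n = Some m -> is_P m = ~~ pl -> ptr s n = Some j -> view pl s j k ->
    view pl s n.+1 k.

(* P-visibility (for P-moves) and O-visibility (for O-moves) *)
Definition visible s : Prop :=
  forall i m k, mv s i = Some m -> ptr s i = Some k -> view (is_P m) s i k.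

(* The question at position k has no answer before position i. *)
Definition pending s (i k : nat) : Prop :=
  [/\ k < i, holds (@is_question D) s k &
      forall j, j < i -> ptr s j = Some k -> holds (@is_question D) s j].

(* Every answer points to the last pending question. *)
Definition well_bracketed s : Prop :=
  forall i m k, mv s i = Some m -> ~~ is_question m -> ptr s i = Some k ->
    pending s i k /\ forall k', pending s i k' -> k' <= k.

Definition play (A : ty) s : Prop :=
  [/\ justified (@initial D) (enables A) s, alternating s, visible s
    & well_bracketed s].

End Plays.

(* A strategy is given by its set of plays, of even and of odd length. *)
Definition strategy (D : Type) : Type := jseq (move D) -> Prop.

(* Restriction of a sequence to the positions in K, with the moves renamed by f
   and the pointers renumbered; pointers to deleted positions are dropped. *)
Definition reindex (K : pred nat) (k : nat) : option nat :=
  if K k then Some (count K (iota 0 k)) else None.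

Definition restrict X Y (K : pred nat) (f : X -> Y) (u : jseq X) : jseq Y :=
  pmap (fun i => if K i then
                   omap (fun x => (f x.1, obind (reindex K) x.2)) (onth u i)
                 else None)
       (iota 0 (size u)).

(** * The denotation of terms

   A term G |- M : T, where G has length p, denotes a strategy on the arena of
   closeT G T.  There, the addresses i :: r with i < p belong to the i-th
   variable of G, and the remaining ones to T: the address of T with first
   component j is shifted to p + j. *)

Section Denotation.
Variable D : Type.

(** ** Variables: copycat between the i-th variable of G and the conclusion *)

Definition in_var (i : nat) (m : move D) : bool := ohead m.1 == Some i.

Definition in_concl (p : nat) (m : move D) : bool :=
  if m.1 is j :: _ then p <= j else true.

Definition var_move (m : move D) : move D := (behead m.1, m.2).

Definition concl_move (p : nat) (m : move D) : move D :=
  (if m.1 is j :: r then j - p :: r else [::], m.2).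

Definition copycat (G : ctx) (i : nat) (A : ty) : strategy D := fun s =>
  play (closeT G A) s /\
  forall n, n <= size s -> ~~ odd n ->
    let t := take n s in
    restrict (holds (in_var i) t) var_move t
    = restrict (holds (in_concl (size G)) t) (concl_move (size G)) t.

(** ** Constants: the opponent's question is answered by the value *)

Definition const_strategy (v : D) : strategy D := fun s =>
  exists n, s = take n [:: (([::], None), None); (([::], Some v), Some 0)].

(** ** Application: parallel composition plus hiding

   Let p be the length of G.  Here sigma is a strategy on (G, A, B), tau one on
   (G, A), and the application is the composite of sigma and tau along A, with
   the two copies of G identified.  The moves of an interaction are the moves
   (true, m) of the arena of sigma, which include those of A, and the moves
   (false, m) with m a move in the copy of G used by tau.  As an initial move of
   A may occur several times, each of its occurrences opens a thread of tau. *)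

Definition imove : Type := (bool * move D)%type.

Section Composition.
Variables (G : ctx) (A B : ty).
Let p := size G.

Definition inM (x : imove) : bool := x.1.
Definition inA (x : imove) : bool := x.1 && in_var p x.2.
Definition ext (x : imove) : bool := ~~ inA x.

Definition initialA : imove := (true, ([:: p], None)).

Definition ienables (x y : imove) : Prop :=
  match x, y with
  | (true, m), (true, m') => enables (closeT G (Arr A B)) m m'
  | (true, _), (false, m') =>
      x = initialA /\
      exists2 i, i < p & m' = ([:: i], None)
  | (false, m), (false, m') => enables (closeT G A) m m'
  | (false, _), (true, _) => False
  end.

Definition iinitial (x : imove) : Prop := x = (true, ([::], None)).

(* Position i is hereditarily justified by position b. *)
Definition hereditary (u : jseq imove) (b i : nat) : bool :=
  has (fun n => iter n (obind (ptr u)) (Some i) == Some b) (iota 0 i.+1).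

(* the move of the arena of (G, A) corresponding to a move of the thread *)
Definition thread_move (x : imove) : move D :=
  if x.1 then
    (if behead x.2.1 is j :: r then p + j :: r else [::], x.2.2)
  else x.2.

Definition projM (u : jseq imove) : jseq (move D) := restrict (holds inM u) snd u.

Definition thread (u : jseq imove) (b : nat) : jseq (move D) :=
  restrict (hereditary u b) thread_move u.

(* A visible move pointing to a hidden one (necessarily an initial move of A)
   inherits the pointer of the latter. *)
Definition shortcut (u : jseq imove) : jseq imove :=
  [seq (x.1, obind (fun k => if holds inA u k then ptr u k else Some k) x.2)
     | x <- u].

(* the move of the arena of (G, B) corresponding to a visible move *)
Definition ext_move (x : imove) : move D :=
  (if x.2.1 is j :: r then (if p < j then j.-1 else j) :: r else [::], x.2.2).

Definition hide (u : jseq imove) : jseq (move D) :=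
  restrict (holds ext u) ext_move (shortcut u).

Definition compose (sigma tau : strategy D) : strategy D := fun s =>
  play (closeT G B) s /\
  exists u : jseq imove,
    [/\ justified iinitial ienables u,
        sigma (projM u),
        forall b, mv u b = Some initialA -> tau (thread u b)
      & s = hide u].

End Composition.

(* position and type of the rightmost declaration of x *)
Fixpoint lookup (G : ctx) (x : nat) : option (nat * ty) :=
  if G is (y, A) :: G' then
    if lookup G' x is Some (i, B) then Some (i.+1, B)
    else if x == y then Some (0, A) else None
  else None.

Fixpoint typeof C (G : ctx) (M : term C) : option ty :=
  match M with
  | Var x => omap snd (lookup G x)
  | Con _ => Some Base
  | App N P =>
      if typeof G N is Some (Arr A B) then
        if typeof G P == Some A then Some B else None
      else None
  | Lam x A N => omap (Arr A) (typeof (rcons G (x, A)) N)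
  end.

(* cv interprets the constants.  Abstraction does not change the strategy, since
   closeT (rcons G (x, A)) B = closeT G (Arr A B).  Ill-typed terms have no
   plays. *)
Fixpoint den C (cv : C -> D) (G : ctx) (M : term C) : strategy D :=
  match M with
  | Var x => if lookup G x is Some (i, A) then copycat G i A else fun=> False
  | Con c => const_strategy (cv c)
  | App N P =>
      if typeof G N is Some (Arr A B) then
        compose G A B (den cv G N) (den cv G P)
      else fun=> False
  | Lam x A N => den cv (rcons G (x, A)) N
  end.

End Denotation.

(* Main.v *)
(* Call a play incrementally justified when every P-move points to the last
   O-question of the P-view whose order exceeds that of the move.  Copycat plays
   are so, and the property survives composition provided the argument strategy
   only calls variables whose order is at least that of its type, which is what
   the side conditions of the safe calculus guarantee.  Hence the P-pointers of a
   safe term are recoverable at every order.  Answers are recovered by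
   well-bracketing, and O-questions at order 3 by O-visibility, since an O-view
   then holds at most one question of depth 1.  At order 4 the argument of psi
   can be called twice, and O may ask for the argument of either call of phi. *)
Require Import Defs.
From mathcomp Require Import all_boot.
From mathcomp Require Import zify.
Set Implicit Arguments.
Unset Strict Implicit.
Unset Printing Implicit Defensive.

Local Notation reindex := Defs.reindex.
Local Notation hide := Defs.hide.

(** The obstacle is that the P-view of a composite crosses hidden moves of several components, so it
    is not a view of any of them. The [trail] replaces it: it walks back through all moves of the
    interaction and jumps only at O-moves of the environment. A hidden O-move of one component is a
    P-move of another, whose incrementality bounds the visible O-questions between that move and its
    justifier by the rank of the move; unfolding hidden moves in this way bounds the whole trail.
    Safety intervenes at a single point. When the argument strategy calls a variable of [G], its
    pointer goes to a hidden initial move of [A] and is redirected to the root. This exposes the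
    segment below that initial move, where only the bound [ord A] is available, so the variable must
    have at least that order. That a composite consists of plays is part of the definition of
    [compose], so only incrementality has to be carried through. *)

Lemma mv_onth X (s : jseq X) i x : mv s i = Some x -> onth s i = Some (x, ptr s i).
Proof. by rewrite /mv /ptr; case: (onth s i) => [[y p]|] //= [->]. Qed.

Lemma onth_mv X (s : jseq X) i x p : onth s i = Some (x, p) -> mv s i = Some x.
Proof. by rewrite /mv => ->. Qed.

Lemma onth_ptr X (s : jseq X) i x p : onth s i = Some (x, p) -> ptr s i = p.
Proof. by rewrite /ptr => ->. Qed.

Lemma mv_size X (s : jseq X) i x : mv s i = Some x -> i < size s.
Proof. by rewrite /mv -onthTE; case: (onth s i). Qed.

Lemma size_mv X (s : jseq X) i : i < size s -> exists x, mv s i = Some x.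
Proof. by rewrite /mv -onthTE; case: (onth s i) => [[x p]|] // _; exists x. Qed.

Lemma ptr_mv X (s : jseq X) i j : ptr s i = Some j -> exists x, mv s i = Some x.
Proof. by rewrite /ptr /mv; case: (onth s i) => [[x p]|] //= _; exists x. Qed.

Lemma holds_mv X (P : X -> bool) (s : jseq X) i x : mv s i = Some x -> holds P s i = P x.
Proof. by rewrite /holds => ->. Qed.

Lemma holdsP X (P : X -> bool) (s : jseq X) i :
  holds P s i -> exists2 x, mv s i = Some x & P x.
Proof. by rewrite /holds; case: (mv s i) => //= x Px; exists x. Qed.

Lemma justified_ptr X (ini : X -> Prop) en (s : jseq X) i x :
  justified ini en s -> mv s i = Some x ->
  if i is 0 then ini x /\ ptr s i = None
  else exists k y, [/\ ptr s i = Some k, k < i, mv s k = Some y & en y x].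
Proof. by move=> js ex; have := js _ _ _ (mv_onth ex); case: i ex. Qed.

Lemma justified_lt X (ini : X -> Prop) en (s : jseq X) i k :
  justified ini en s -> ptr s i = Some k -> k < i.
Proof.
move=> js e; have [x ex] := ptr_mv e; have := justified_ptr js ex.
by case: i e ex => [|i] e ex; rewrite e; [case | case=> k' [y] [[<-]]].
Qed.

(** * Restriction to a set of positions *)

(** The index that position [i] receives after restriction to [K]; [reindex] returns the same
    number, but only on [K]. *)
Definition rank_in (K : pred nat) (i : nat) : nat := count K (iota 0 i).

Lemma rank_inS (K : pred nat) i : rank_in K i.+1 = rank_in K i + K i.
Proof. by rewrite /rank_in -addn1 iotaD count_cat /= addn0. Qed.

Lemma rank_in_lt (K : pred nat) i j : K i -> i < j -> rank_in K i < rank_in K j.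
Proof.
move=> Ki; elim: j => // j IH; rewrite rank_inS ltnS leq_eqVlt => /predU1P[<-|/IH lt].
  by rewrite Ki addn1.
by rewrite ltn_addr.
Qed.

Lemma rank_in_ltE (K : pred nat) i j : K i -> K j -> (rank_in K i < rank_in K j) = (i < j).
Proof.
move=> Ki Kj; case: (ltngtP i j) => [/(rank_in_lt Ki)->//|/(rank_in_lt Kj)|->].
  by case: ltngtP.
by rewrite ltnn.
Qed.

Lemma rank_in_inj (K : pred nat) i j : K i -> K j -> rank_in K i = rank_in K j -> i = j.
Proof.
move=> Ki Kj e; have := rank_in_ltE Ki Kj; have := rank_in_ltE Kj Ki.
by rewrite e ltnn; case: ltngtP.
Qed.

Lemma rank_in_eq (K K' : pred nat) n : (forall i, i < n -> K i = K' i) -> rank_in K n = rank_in K' n.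
Proof. by move=> e; apply: eq_in_count => i; rewrite mem_iota /= add0n => /e. Qed.

Lemma onth_pmap_iota T (g : nat -> option T) N i y :
  i < N -> g i = Some y ->
  onth (pmap g (iota 0 N)) (rank_in (fun i => g i) i) = Some y.
Proof.
move=> lt e; rewrite -(subnKC lt) iotaD pmap_cat onth_cat size_pmap.
have -> : rank_in (fun i => g i) i < count [eta g] (iota 0 i.+1).
  by have := @rank_inS (fun i => g i) i; rewrite /rank_in => ->; rewrite e /= addn1.
rewrite -addn1 iotaD pmap_cat onth_cat size_pmap /rank_in ltnn subnn add0n.
by rewrite [pmap _ _]/= e.
Qed.

Lemma onth_pmap_iotaP T (g : nat -> option T) N r y :
  onth (pmap g (iota 0 N)) r = Some y ->
  exists i, [/\ i < N, g i = Some y & r = rank_in (fun i => g i) i].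
Proof.
elim: N => [|N IH]; first by rewrite onth0n.
rewrite -addn1 iotaD pmap_cat onth_cat size_pmap add0n.
case: ltnP => [_ /IH [i [lt e er]]|le]; first by exists i; split=> //; lia.
rewrite /= /oapp; case eg: (g N) => [z|]; last by rewrite onth0n.
move=> /= /onth1P [e0 <-]; exists N; split=> //; first by lia.
by move: e0 le; rewrite /rank_in; lia.
Qed.

Section Restrict.
Variables (X Y : Type) (K : pred nat) (f : X -> Y) (u : jseq X).

Let g i := if K i then omap (fun x => (f x.1, obind (reindex K) x.2)) (onth u i) else None.

Lemma rank_in_restrict i : i <= size u -> rank_in (fun i => g i) i = rank_in K i.
Proof.
move=> le; apply: rank_in_eq => j lt; rewrite /g; case: (K j) => //.
have : j < size u by apply: leq_trans le.
by rewrite -onthTE; case: (onth u j).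
Qed.

Lemma onth_restrict i x p :
  onth u i = Some (x, p) -> K i ->
  onth (restrict K f u) (rank_in K i) = Some (f x, obind (reindex K) p).
Proof.
move=> e Ki; have lt : i < size u by rewrite -onthTE e.
rewrite -rank_in_restrict ?(ltnW lt) //; apply: onth_pmap_iota => //.
by rewrite /g Ki e.
Qed.

Lemma onth_restrictP r y q :
  onth (restrict K f u) r = Some (y, q) ->
  exists i x p, [/\ onth u i = Some (x, p), K i, r = rank_in K i, y = f x & q = obind (reindex K) p].
Proof.
move=> h; have [i [lt]] := @onth_pmap_iotaP _ g _ _ _ h; rewrite {1}/g; case Ki: (K i) => //.
case e: (onth u i) => [[x p]|] //= [<- <-] er; exists i, x, p; split=> //.
by rewrite er rank_in_restrict // ltnW.
Qed.

Lemma mv_restrict i x : mv u i = Some x -> K i ->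
  mv (restrict K f u) (rank_in K i) = Some (f x).
Proof. by move=> e Ki; rewrite (onth_mv (onth_restrict (mv_onth e) Ki)). Qed.

Lemma mv_restrictP r y : mv (restrict K f u) r = Some y ->
  exists i x, [/\ mv u i = Some x, K i, r = rank_in K i & y = f x].
Proof.
move=> h; have [i [x [p [e Ki -> -> _]]]] := onth_restrictP (mv_onth h).
by exists i, x; rewrite (onth_mv e).
Qed.

Lemma ptr_restrict i : i < size u -> K i ->
  ptr (restrict K f u) (rank_in K i) = obind (reindex K) (ptr u i).
Proof.
move=> /size_mv [x e] Ki.
by rewrite (onth_ptr (onth_restrict (mv_onth e) Ki)).
Qed.

Lemma size_restrict : size (restrict K f u) = rank_in K (size u).
Proof. by rewrite size_pmap -rank_in_restrict. Qed.

End Restrict.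

Lemma reindexT (K : pred nat) k : K k -> reindex K k = Some (rank_in K k).
Proof. by rewrite /reindex => ->. Qed.
(** * Orders of moves and views *)

Definition ordat (T : ty) (r : seq nat) : nat := if subty T r is Some B then ord B else 0.

(* Answers get rank 0, so that [incremental] constrains them too. *)
Definition rank D (T : ty) (m : move D) : nat := if m.2 is None then (ordat T m.1).+1 else 0.

(** Only O-questions strictly above the justifier are bounded. That the justifier of a question has
    larger order than the question is automatic, since enabling lowers the order ([ordat_rcons]). *)
Definition incremental D (T : ty) (s : jseq (move D)) : Prop :=
  forall i m k e q, mv s i = Some m -> is_P m -> ptr s i = Some k ->
    view true s i e -> k < e -> mv s e = Some (q, None) -> ~~ odd (size q) ->
    ordat T q < rank T m.

Lemma args_closeT G T : args (closeT G T) = unzip2 G ++ args T.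
Proof. by elim: G => //= x G ->. Qed.

Lemma subty_closeT_var G T i r x B :
  onth G i = Some (x, B) -> subty (closeT G T) (i :: r) = subty B r.
Proof.
move=> e; rewrite /= args_closeT onth_cat size_map -onthTE e /=.
by rewrite /unzip2 onth_map e.
Qed.

Lemma subty_closeT_concl G T j r :
  subty (closeT G T) (size G + j :: r) = subty T (j :: r).
Proof. by rewrite /= args_closeT onth_cat size_map ltnNge leq_addr /= addKn. Qed.

Lemma subty_closeT_concl' G T j r :
  size G <= j -> subty (closeT G T) (j :: r) = subty T (j - size G :: r).
Proof. by move=> le; rewrite -{1}(subnKC le) subty_closeT_concl. Qed.

Lemma closeT_cat G H T : closeT (G ++ H) T = closeT G (closeT H T).
Proof. exact: foldr_cat. Qed.

Lemma enables_is_P D A (m m' : move D) : enables A m m' -> is_P m' = ~~ is_P m.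
Proof.
case: m => r o [/= -> _ [[i ->]|[v ->]]]; rewrite /is_P /= ?size_rcons /=.
  by rewrite !addbF.
by rewrite addbT addbF.
Qed.

Lemma view0 D pl (s : jseq (move D)) k : ~ view pl s 0 k.
Proof. by move e: 0 => z h; case: h e. Qed.

Lemma viewS D pl (s : jseq (move D)) n k : view pl s n.+1 k ->
  exists2 m, mv s n = Some m &
  k = n \/ (is_P m = pl /\ view pl s n k) \/
  (is_P m = ~~ pl /\ exists2 j, ptr s n = Some j & k = j \/ view pl s j k).
Proof.
move e: n.+1 => z h; case: h e => {z k}.
- by move=> z /size_mv [m em] [->]; exists m => //; left.
- by move=> z m k em pm v [->]; exists m => //; right; left.
- by move=> z m j em pm ej [->]; exists m => //; right; right; split=> //; exists j; auto.
- by move=> z m j k em pm ej v [->]; exists m => //; right; right; split=> //; exists j; auto.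
Qed.

Lemma view_lt D pl A (s : jseq (move D)) n k : play A s -> view pl s n k -> k < n.
Proof.
case=> js _ _ _; elim=> {n k} //.
- by move=> n m k _ _ _ /ltnW.
- by move=> n m j _ _ /(justified_lt js) /ltnW.
- by move=> n m j k _ _ /(justified_lt js) lt _ lt'; lia.
Qed.

(** * Views of a restriction, read in the original sequence *)

Section Transfer.
Variables (D X : Type) (K : pred nat) (f : X -> move D) (u : jseq X).
Let s := restrict K f u.

Lemma view_restrict_last pl n : n < size u -> K n ->
  view pl s (rank_in K n.+1) (rank_in K n).
Proof.
move=> lt Kn; rewrite rank_inS Kn addn1; apply: view_last.
by rewrite size_restrict; apply: rank_in_lt.
Qed.

Lemma view_restrict_other pl n x j k : mv u n = Some x -> K n -> is_P (f x) = ~~ pl ->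
  ptr u n = Some j -> K j -> view pl s (rank_in K j) k -> view pl s (rank_in K n.+1) k.
Proof.
move=> ex Kn px ej Kj; rewrite rank_inS Kn addn1.
apply: view_other px _; first exact: mv_restrict ex Kn.
by rewrite ptr_restrict ?(mv_size ex) // ej /= reindexT.
Qed.

Lemma view_restrictS pl n k : K n -> view pl s (rank_in K n.+1) k ->
  exists2 x, mv u n = Some x &
  k = rank_in K n \/ (is_P (f x) = pl /\ view pl s (rank_in K n) k) \/
  (is_P (f x) = ~~ pl /\ exists j,
     [/\ ptr u n = Some j, K j & k = rank_in K j \/ view pl s (rank_in K j) k]).
Proof.
move=> Kn; rewrite rank_inS Kn addn1 => /viewS [m em h].
have [i [x [ex Ki ei em']]] := mv_restrictP em.
have ein := rank_in_inj Kn Ki ei; subst i; exists x => //; rewrite -em'.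
case: h => [->|[h|[pm [j]]]]; [by left | by right; left |].
rewrite ptr_restrict ?(mv_size ex) //; case: (ptr u n) => //= j0.
rewrite /Defs.reindex -/(rank_in K j0); case: ifP => // Kj [<-] h.
by right; right; split=> //; exists j0.
Qed.

Lemma play_restrict_just T n x j : play T s -> mv u n = Some x -> K n ->
  ptr u n = Some j -> K j -> exists2 y, mv u j = Some y & enables T (f y) (f x).
Proof.
move=> [js _ _ _] ex Kn ej Kj; have ex' := mv_restrict f ex Kn.
have /size_mv [y ey] : j < size u.
  have : ptr s (rank_in K n) = Some (rank_in K j).
    by rewrite ptr_restrict ?(mv_size ex) // ej /= reindexT.
  move=> e; have lt := justified_lt js e; have := mv_size ex.
  by move: lt; rewrite rank_in_ltE //; apply: ltn_trans.
exists y => //; have := justified_ptr js ex'.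
have ep : ptr s (rank_in K n) = Some (rank_in K j).
  by rewrite ptr_restrict ?(mv_size ex) // ej /= reindexT.
rewrite -/s ep; case: (rank_in K n) => [|r]; first by case.
by case=> k [m [[<-] _ em en]]; move: em en; rewrite (mv_restrict f ey Kj) => -[<-].
Qed.
End Transfer.

(** * Interactions *)

Section Interaction.
Variables (D : Type) (G : ctx) (A B : ty) (u : jseq (imove D)).
Let p := size G.
Hypothesis ju : justified (@iinitial D) (ienables G A B) u.

Lemma interaction_ptr n x : mv u n = Some x ->
  if n is 0 then x = (true, ([::], None)) /\ ptr u n = None
  else exists k y, [/\ ptr u n = Some k, k < n, mv u k = Some y & ienables G A B y x].
Proof. exact: (justified_ptr ju). Qed.

Lemma interaction_root n o : mv u n = Some (true, ([::], o)) -> o = None -> n = 0.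
Proof.
move=> ex e; move: ex; rewrite {}e => /interaction_ptr; case: n => // n [k [[[] m] [_ _ _ //]]].
by case=> _ _ [[i []]|[v []]] //; case: m.1.
Qed.

(** Moves tagged [false] start at an initial move of a variable of [G], and enabling only extends or
    answers an address, so its head is inherited. *)
Lemma interaction_false_head n m : mv u n = Some (false, m) ->
  exists j r, m.1 = j :: r /\ j < p.
Proof.
elim/ltn_ind: n m => n IH m /interaction_ptr; case: n IH => [|n] IH; first by case.
case=> k [[[] m'] [_ lt ek]] /=; first by case=> _ [j lt' ->]; exists j, [::].
have [j [r [e ltj]]] := IH _ lt _ ek.
by case=> _ _ [[i ->]|[v ->]] /=; rewrite e; exists j; eexists.
Qed.

Lemma interaction_initialA b : mv u b = Some (initialA D G) -> ptr u b = Some 0.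
Proof.
move=> e; have := interaction_ptr e; case: b e => [|b] e; first by case.
case=> k [[[] [r o]] [ek _ mk]]; last by [].
case=> /= eo _ [[i [er]]|[v //]]; subst o; rewrite ek.
case: r er mk => [|j [|j' r]] // _ mk.
by rewrite (interaction_root mk).
Qed.

Lemma iter_obind_None (g : nat -> option nat) n : iter n (obind g) None = None.
Proof. by elim: n => //= n ->. Qed.

(** Pointers strictly decrease, so the bounded search in [hereditary] loses nothing. *)
Lemma hereditaryP b i :
  reflect (exists n, iter n (obind (ptr u)) (Some i) = Some b) (hereditary u b i).
Proof.
apply: (iffP hasP) => [[n _ /eqP]|[n e]]; first by exists n.
exists n; last by rewrite e.
rewrite mem_iota /= add0n ltnS; elim: n i e => // n IH i; rewrite iterSr /=.
case e: (ptr u i) => [j|] /=; last by rewrite iter_obind_None.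
by move=> /IH le; apply: leq_ltn_trans le (justified_lt ju e).
Qed.

Lemma hereditary_rec b i :
  hereditary u b i = (i == b) || (if ptr u i is Some j then hereditary u b j else false).
Proof.
apply/hereditaryP/idP => [[[|n]]|]; first by case=> ->; rewrite eqxx.
  rewrite iterSr /=; case: (ptr u i) => [j|] /=; last by rewrite iter_obind_None.
  by move=> e; apply/orP; right; apply/hereditaryP; exists n.
case/orP => [/eqP->|]; first by exists 0.
case e: (ptr u i) => [j|//] /hereditaryP [n en].
by exists n.+1; rewrite iterSr /= e.
Qed.

Lemma hereditary_refl b : hereditary u b b.
Proof. by rewrite hereditary_rec eqxx. Qed.

Lemma hereditary_leq b i : hereditary u b i -> b <= i.
Proof.
elim/ltn_ind: i => i IH; rewrite hereditary_rec => /predU1P[->//|].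
case e: (ptr u i) => [j|//] h; have lt := justified_lt ju e.
by apply: leq_trans (IH _ lt h) (ltnW lt).
Qed.

Lemma initialA_gt0 b : mv u b = Some (initialA D G) -> 0 < b.
Proof. by case: b => // /interaction_ptr []. Qed.

Lemma hereditary0 b : mv u b = Some (initialA D G) -> hereditary u b 0 = false.
Proof.
move=> /initialA_gt0 b0; apply/negbTE/negP => /hereditary_leq; lia.
Qed.

Definition threaded (x : imove D) : bool := ~~ x.1 || inA G x.

Lemma ienables_threaded x y : ienables G A B x y -> y <> initialA D G ->
  threaded x = threaded y.
Proof.
case: x y => [[] m] [[] m'] //=.
- case: m => r o; rewrite /threaded /inA /in_var /=.
  case=> /= eo _ [[i ->]|[v ->]] //=; subst o.
  case: r => [|j r] //= ne; apply/esym/negbTE/eqP => -[e]; apply: ne.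
  by rewrite e.
- by case=> -> _ _; rewrite /threaded /inA /in_var /= eqxx.
Qed.

(** A threaded move other than an initial move of [A] has a threaded justifier, so its pointers lead
    back to exactly one opening of a thread. The openings themselves point to the root, which is in
    no thread. *)
Lemma thread_unique n x : mv u n = Some x ->
  if threaded x then exists2 b, mv u b = Some (initialA D G) &
    forall b', mv u b' = Some (initialA D G) -> hereditary u b' n = (b' == b)
  else forall b', mv u b' = Some (initialA D G) -> hereditary u b' n = false.
Proof.
elim/ltn_ind: n x => n IH x ex; have := interaction_ptr ex.
case: n IH ex => [|n] IH ex.
  by case=> ex0 _; rewrite ex0 /threaded /inA /in_var /= => b'; apply: hereditary0.
case=> k [y [ek lt ey en]].
have [bx|nbx] : (n.+1, x) = (n.+1, initialA D G) \/ x <> initialA D G.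
- case: x ex en => [[] [[|j [|j' r]] [v|]]] ex en; try by right.
  by case: (eqVneq j p) => [->|ne]; [left | right=> -[/eqP]; apply/negP].
- case: bx => ex0; subst x; rewrite /threaded /inA /in_var /= eqxx.
  exists n.+1 => // b' mb'; rewrite hereditary_rec (interaction_initialA ex).
  by rewrite hereditary0 // orbF eq_sym.
rewrite -(ienables_threaded en nbx).
have ne b' : mv u b' = Some (initialA D G) -> (n.+1 == b') = false.
  by move=> mb'; apply/negP => /eqP e; subst b'; apply: nbx; move: mb'; rewrite ex => -[].
have := IH _ lt _ ey; case: (threaded y) => [[b mb h]|h].
  by exists b => // b' mb'; rewrite hereditary_rec ek ne //= h.
by move=> b' mb'; rewrite hereditary_rec ek ne //= h.
Qed.

(** ** Components *)

(* [None] is the component of sigma, [Some b] the thread of tau opened at b. *)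
Definition valid (c : option nat) : Prop :=
  if c is Some b then mv u b = Some (initialA D G) else True.
Definition inC (c : option nat) : pred nat :=
  if c is Some b then hereditary u b else holds (@inM D) u.
Definition moveC (c : option nat) : imove D -> move D :=
  if c is Some b then thread_move G else snd.
Definition tyC (c : option nat) : ty :=
  if c is Some b then closeT G A else closeT G (Arr A B).
Definition playC (c : option nat) : jseq (move D) := restrict (inC c) (moveC c) u.
Definition isPC (c : option nat) (x : imove D) : bool := is_P (moveC c x).
Definition extO (x : imove D) : bool := ext G x && ~~ is_P x.2.
Definition initC (c : option nat) : nat := odflt 0 c.

Lemma inC_init c n : inC c n -> initC c <= n.
Proof. by case: c => [b|//]; apply: hereditary_leq. Qed.

Lemma inC_None n x : mv u n = Some x -> inC None n = x.1.
Proof. by move=> ex; rewrite /inC (holds_mv _ ex). Qed.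

Lemma extE (x : imove D) : ext G x = ~~ x.1 || ~~ in_var p x.2.
Proof. by rewrite /ext /inA negb_and. Qed.

Lemma isPC_ext c n x : valid c -> mv u n = Some x -> inC c n -> ext G x -> isPC c x = is_P x.2.
Proof.
case: c => [b|] // vb ex cn; rewrite extE.
case: x ex => [[] m] ex //= nv.
by have := thread_unique ex; rewrite /threaded /inA /= (negbTE nv) => /(_ _ vb); rewrite -/(inC (Some b) n) cn.
Qed.

(** The address [p :: r] of a hidden move in the arena of sigma becomes [r], up to a shift of its
    head, in the arena of tau; the length changes parity. *)
Lemma isPC_hidden b x : inA G x -> isPC (Some b) x = ~~ isPC None x.
Proof.
case: x => [[] [[|j r] o]] //; rewrite /inA /in_var /= => /eqP [->].
by rewrite /isPC /= /thread_move /is_P /=; case: r => [|i r] //=;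
  case: o => //=; case: odd.
Qed.

Lemma ext_component n x : mv u n = Some x -> ext G x ->
  exists c, [/\ valid c, inC c n & forall c', valid c' -> inC c' n -> c' = c].
Proof.
move=> ex e; have := thread_unique ex; rewrite /threaded.
have -> : inA G x = false by apply/negbTE.
rewrite orbF; case x1: x.1 => /=.
  move=> h; exists None; split=> //=; first by rewrite -/(inC None n) (inC_None ex).
  by case=> [b|] // vb; rewrite /= h.
case=> b mb h; exists (Some b); split=> //=; first by rewrite h.
case=> [b'|] /= vb'; first by rewrite h // => /eqP->.
by rewrite -/(inC None n) (inC_None ex) x1.
Qed.

Lemma hidden_component n x : mv u n = Some x -> inA G x ->
  inC None n /\ exists b, [/\ valid (Some b), inC (Some b) n &
    forall c', valid c' -> inC c' n -> c' = None \/ c' = Some b].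
Proof.
move=> ex e; have := thread_unique ex; rewrite /threaded e orbT => -[b mb h].
split; first by rewrite (inC_None ex); case/andP: e.
exists b; split=> //=; first by rewrite h.
case=> [b'|] /= vb'; last by left.
by rewrite h // => /eqP->; right.
Qed.

(** A visible move keeps its polarity in its only component, and a hidden one is a P-move on one of
    its two sides. Only visible O-moves come from the environment. *)
Lemma P_component n x : mv u n = Some x -> ~~ extO x ->
  exists c, [/\ valid c, inC c n & isPC c x].
Proof.
move=> ex; rewrite /extO; case h: (inA G x).
  have [cn [b [vb bn _]]] := hidden_component ex h => _.
  case px: (isPC None x); first by exists None.
  by exists (Some b); rewrite isPC_hidden // px.
rewrite /ext h /= negbK => px; have e : ext G x by rewrite /ext h.
have [c [vc cn _]] := ext_component ex e.
by exists c; rewrite (isPC_ext vc ex cn).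
Qed.

Lemma component_just c n x : valid c -> mv u n = Some x -> inC c n -> n <> initC c ->
  exists j y, [/\ ptr u n = Some j, j < n, mv u j = Some y, ienables G A B y x & inC c j].
Proof.
move=> vc ex cn ne; have := interaction_ptr ex.
case: n ex cn ne => [|n] ex cn ne.
  by case: ne; move: (inC_init cn); case: (initC c).
case=> k [y [ek lt ey en]]; exists k, y; split=> //.
case: c vc cn ne => [b|] vc cn ne.
  by move: cn; rewrite /= hereditary_rec ek => /predU1P[/ne|].
rewrite (inC_None ey); move: cn; rewrite (inC_None ex).
by case: x ex en => [[] m] ex en //; case: y ey en => [[] m'].
Qed.

(** * Switching: whose turn it is in each component *)

Hypothesis plays : forall c, valid c -> play (tyC c) (playC c).
Hypothesis alt_hide : alternating (hide G u).

Lemma component_flip c n x j y : valid c -> mv u n = Some x -> inC c n -> ptr u n = Some j ->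
  inC c j -> mv u j = Some y -> isPC c x = ~~ isPC c y.
Proof.
move=> vc ex cn ej cj ey; have [y' ey'] := play_restrict_just (plays vc) ex cn ej cj.
by rewrite ey in ey'; case: ey' => <- /enables_is_P.
Qed.

Lemma component_parity c n x : valid c -> mv u n = Some x -> inC c n ->
  isPC c x = odd (rank_in (inC c) n).
Proof.
move=> vc ex cn; have [_ al _ _] := plays vc.
by apply: al; apply: mv_restrict.
Qed.

Lemma mv_shortcut n : mv (shortcut G u) n = mv u n.
Proof. by rewrite /mv /shortcut onth_map; case: (onth u n). Qed.

Lemma ptr_shortcut n : ptr (shortcut G u) n =
  obind (fun k => if holds (inA G) u k then ptr u k else Some k) (ptr u n).
Proof. by rewrite /ptr /shortcut onth_map; case: (onth u n). Qed.

Definition inExt : pred nat := holds (ext G) u.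

Lemma hide_restrict : hide G u = restrict inExt (ext_move G) (shortcut G u).
Proof. by []. Qed.

Lemma is_P_ext_move x : is_P (ext_move G x) = is_P (D := D) x.2.
Proof. by rewrite /is_P /ext_move /=; case: (x.2.1). Qed.

Lemma ext_parity n x : mv u n = Some x -> inExt n -> is_P x.2 = odd (rank_in inExt n).
Proof.
move=> ex en; rewrite -is_P_ext_move; apply: alt_hide; rewrite hide_restrict.
by apply: mv_restrict => //; rewrite mv_shortcut.
Qed.

(* After n moves it is P's turn in component c, resp. O's turn everywhere. *)
Definition active (c : option nat) (n : nat) : Prop :=
  [/\ valid c, odd (rank_in (inC c) n), odd (rank_in inExt n)
    & forall c', valid c' -> odd (rank_in (inC c') n) -> c' = c].
Definition idle (n : nat) : Prop :=
  ~~ odd (rank_in inExt n) /\ forall c, valid c -> ~~ odd (rank_in (inC c) n).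

Lemma mover n x : mv u n = Some x ->
  [\/ extO x /\ inExt n,
      [/\ ext G x, is_P x.2 & inExt n] | inA G x].
Proof.
move=> ex; rewrite /extO /inExt (holds_mv _ ex) /ext.
by case: (inA G x); [apply: Or33 | case: (is_P x.2); [apply: Or32 | apply: Or31]].
Qed.

(** The state diagram of an interaction, read off the parities of lengths: a visible O-move wakes
    its component, a visible P-move ends the activity, and a hidden move hands it over between sigma
    and a thread. The other transitions contradict alternation. *)
Lemma switching n : n <= size u -> idle n \/ exists c, active c n.
Proof.
elim: n => [|n IH] lt; first by left; split.
have [x ex] := size_mv lt; have := IH (ltnW lt).
have upd (K : pred nat) : odd (rank_in K n.+1) = K n (+) odd (rank_in K n).
  by rewrite rank_inS oddD oddb addbC.
case=> [[nE nC]|[c [vc oc oE uc]]].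
  case: (mover ex) => [[/andP[e np] en]|[e ip en]|hid].
  - have [c [vc cn uc]] := ext_component ex e.
    right; exists c; split=> //; first by rewrite upd cn (negPf (nC _ vc)).
      by rewrite upd en (negPf nE).
    move=> c' vc'; rewrite upd (negPf (nC _ vc')) addbF; exact: uc.
  - by move: ip; rewrite (ext_parity ex en) (negPf nE).
  - have [cn [b [vb bn _]]] := hidden_component ex hid.
    have := component_parity vb ex bn; have := @component_parity None _ _ I ex cn.
    by rewrite isPC_hidden // => ->; rewrite (negPf (nC _ vb)) (negPf (nC None I)).
case: (mover ex) => [[/andP[e np] en]|[e ip en]|hid].
- by move: np; rewrite (ext_parity ex en) oE.
- have [d [vd dn ud]] := ext_component ex e.
  have ed : d = c.
    by apply: uc => //; rewrite -(component_parity vd ex dn) (isPC_ext vd ex dn).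
  subst d; left; split; first by rewrite upd en oE.
  move=> c' vc'; rewrite upd; case cn: (inC c' n).
    by rewrite (ud _ vc' cn) oc.
  apply/negP=> /= oc'; move: cn; rewrite (uc _ vc' oc') dn //.
have [cn [b [vb bn ub]]] := hidden_component ex hid; right.
have en : inExt n = false by rewrite /inExt (holds_mv _ ex) /ext hid.
have := component_parity vb ex bn; have := @component_parity None _ _ I ex cn.
rewrite isPC_hidden // => -> ob.
have [ec|ec] : c = None \/ c = Some b.
- case o0: (odd (rank_in (inC None) n)); first by left; rewrite (uc None).
  by right; rewrite (uc (Some b)) // -ob o0.
- subst c; exists (Some b); split=> //.
  + by rewrite upd bn -ob oc.
  + by rewrite upd en.
  + move=> c' vc'; rewrite upd; case c'n: (inC c' n) => /= oc'.
      by case: (ub _ vc' c'n) oc' => // ->; rewrite oc.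
    by move: c'n; rewrite (uc _ vc' oc') cn.
subst c; exists None; split=> //.
- by rewrite upd cn; move: ob; rewrite oc; case: odd.
- by rewrite upd en.
move=> c' vc'; rewrite upd; case c'n: (inC c' n) => /= oc'.
  by case: (ub _ vc' c'n) oc' => // ->; rewrite oc.
by move: c'n; rewrite (uc _ vc' oc') bn.
Qed.

(** If the preceding move were outside [c], then [c] was already to play before it. Alternation of
    the visible sequence excludes a visible O-move there, and any other move is a P-move of the
    active component, which is [c]. *)
Lemma component_pred c n x : valid c -> mv u n = Some x -> inC c n -> isPC c x ->
  exists m y, [/\ n = m.+1, mv u m = Some y, inC c m & ~~ isPC c y].
Proof.
move=> vc ex cn px; have oc := component_parity vc ex cn; rewrite px in oc.
case: n ex cn oc => [|m] ex cn oc //; have lt := mv_size ex.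
have [y ey] := size_mv (ltnW lt); exists m, y.
have upd (K : pred nat) : odd (rank_in K m.+1) = K m (+) odd (rank_in K m).
  by rewrite rank_inS oddD oddb addbC.
have key : inC c m.
  move: oc; rewrite upd; case cm: (inC c m) => //= /esym oc.
  case: (switching (ltnW (ltnW lt))) => [[_ /(_ _ vc)]|[d [vd od oE ud]]]; first by rewrite oc.
  have ed := ud _ vc oc; rewrite -{}ed in ud.
  case xo: (extO y).
    case/andP: xo => e; rewrite (ext_parity ey) ?oE // /inExt (holds_mv _ ey) //.
  have [d' [vd' dn pd]] := P_component ey (negbT xo).
  have ed : d' = c by apply: ud => //; rewrite -(component_parity vd' ey dn).
  by rewrite ed cm in dn.
split=> //; rewrite (component_parity vc ey key); move: oc; rewrite upd key.
by case: odd.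
Qed.

(** ** The external P-view inside an interaction *)

Definition iord (x : imove D) : nat :=
  ordat (if x.1 then closeT G (Arr A B) else closeT G A) x.2.1.
Definition irank (x : imove D) : nat := if x.2.2 is None then (iord x).+1 else 0.

Lemma moveC2 c x : (moveC c x).2 = x.2.2.
Proof. by case: c => [b|] //; rewrite /= /thread_move; case: x.1. Qed.

(** The condition [n <> initC c] matters for threads: their root carries the order of [closeT G A],
    whereas [iord] gives it that of [A]. *)
Lemma ordat_moveC c n x : valid c -> mv u n = Some x -> inC c n -> n <> initC c ->
  x.2.2 = None -> ordat (tyC c) (moveC c x).1 = iord x.
Proof.
move=> vc ex cn ne; case: c vc cn ne => [b|] vc cn ne; last first.
  by move: cn; rewrite (inC_None ex) /iord => ->.
case: x ex => [[] [r o]] // ex /= eo; subst o.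
have := thread_unique ex; rewrite /threaded /= /inA /in_var /= /iord /=.
case: ifP => [h|_ /(_ _ vc)]; last by rewrite -/(inC (Some b) n) cn.
case: r ex h => [|i r] //= ex /eqP [ei]; subst i; case: r ex => [|j r] ex.
  case=> b' mb' h; case: ne; have := h _ vc; rewrite -/(inC (Some b) n) cn => /esym/eqP ->.
  by have := h _ ex; rewrite hereditary_refl => /esym/eqP.
move=> _; rewrite /ordat subty_closeT_concl.
by rewrite (@subty_closeT_concl' G (Arr A B)) // subnn.
Qed.

(* The positions met when walking back from position n, jumping over the
   justification pointers of the external O-moves; it contains the
   P-view of the composite. *)
Inductive trail : nat -> nat -> Prop :=
| trail_last n x : mv u n = Some x -> trail n.+1 n
| trail_step n x k : mv u n = Some x -> ~~ extO x -> trail n k -> trail n.+1 k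
| trail_just n x j : mv u n = Some x -> extO x -> ptr u n = Some j -> trail n.+1 j
| trail_jump n x j k :
    mv u n = Some x -> extO x -> ptr u n = Some j -> trail j k -> trail n.+1 k.

Lemma trailS n k x : trail n.+1 k -> mv u n = Some x ->
  k = n \/ (~~ extO x /\ trail n k) \/
  (extO x /\ exists2 j, ptr u n = Some j & k = j \/ trail j k).
Proof.
move e: n.+1 => z h; case: h e => {z k} z y => [|k|j|j k] ey.
- by case=> ->; left.
- by move=> o t [->]; rewrite ey => -[<-]; right; left.
- by move=> o ej [->]; rewrite ey => -[<-]; right; right; split=> //; exists j; auto.
- by move=> o ej t [->]; rewrite ey => -[<-]; right; right; split=> //; exists j; auto.
Qed.

Lemma trail_lt n k : trail n k -> k < n.
Proof.
elim=> {n k} // [n x k _ _ _ /ltnW //|n x j _ _ /(justified_lt ju) /ltnW //|].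
by move=> n x j k _ _ /(justified_lt ju) lt _ lt'; lia.
Qed.

(** From a position without a visible O-move the walk proceeds to the predecessor, so below that
    position it coincides with the trail of the position; [trail_linear] is the converse
    inclusion. *)
Lemma trail_trans n a y k : trail n a -> mv u a = Some y -> ~~ extO y -> trail a k -> trail n k.
Proof.
move=> h; elim: h y k => {n a} [n x|n x a|n x j|n x j a] ex.
- by move=> y k ey o t; apply: trail_step o t.
- by move=> o _ IH y k ey oy t; apply: trail_step o _ => //; apply: IH ey oy t.
- by move=> o ej y k ey oy t; apply: trail_jump o ej t.
- by move=> o ej _ IH y k ey oy t; apply: trail_jump o ej _ => //; apply: IH ey oy t.
Qed.

Lemma trail_linear n a y e : trail n a -> mv u a = Some y -> ~~ extO y ->
  trail n e -> e < a -> trail a e.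
Proof.
move=> h; elim: h y e => {n a} [n x|n x a|n x j|n x j a] ex.
- move=> y e ey oy t lt; case: (trailS t ex) => [ee|[[]//|[o]]]; first by lia.
  by move: ey oy; rewrite ex => -[<-]; rewrite o.
- move=> o ta IH y e ey oy t lt; have lta := trail_lt ta.
  case: (trailS t ex) => [ee|[[_ t']|[o']]]; [by lia | exact: IH ey oy t' lt |].
  by rewrite o' in o.
- move=> o ej y e ey oy t lt; have ltj := justified_lt ju ej.
  case: (trailS t ex) => [ee|[[o' _]|[_ [j']]]]; [by lia | by rewrite o in o' |].
  by rewrite ej => -[<-] [ee|//]; lia.
- move=> o ej ta IH y e ey oy t lt; have ltj := justified_lt ju ej; have lta := trail_lt ta.
  case: (trailS t ex) => [ee|[[o' _]|[_ [j']]]]; [by lia | by rewrite o in o' |].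
  rewrite ej => -[<-] [ee|t']; [by lia | exact: IH ey oy t' lt].
Qed.

Lemma isPC_not_extO c n x : valid c -> mv u n = Some x -> inC c n -> isPC c x -> ~~ extO x.
Proof.
move=> vc ex cn px; apply/negP => /andP[e]; rewrite -(isPC_ext vc ex cn e).
by rewrite px.
Qed.

Lemma just_isPC c n x j : valid c -> mv u n = Some x -> inC c n -> ~~ isPC c x ->
  ptr u n = Some j -> inC c j -> exists2 y, mv u j = Some y & isPC c y.
Proof.
move=> vc ex cn px ej cj; have [y ey _] := play_restrict_just (plays vc) ex cn ej cj.
exists y => //; move: px; rewrite (component_flip vc ex cn ej cj ey).
by rewrite negbK.
Qed.

Lemma isPC_initC c x : valid c -> mv u (initC c) = Some x -> ~~ isPC c x.
Proof.
case: c => [b|] /=; first by move=> -> [<-].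
by move=> _ /interaction_ptr [->].
Qed.

Lemma extO_just n x j : mv u n = Some x -> extO x -> ptr u n = Some j ->
  exists c y, [/\ valid c, inC c n, inC c j, mv u j = Some y & isPC c y].
Proof.
move=> ex o ej; have /andP[e pe] := o; have [c [vc cn _]] := ext_component ex e.
have [j' [y [ej' _ ey _ cj]]] : exists j' y, [/\ ptr u n = Some j', j' < n, mv u j' = Some y,
    ienables G A B y x & inC c j'].
  apply: component_just => // en; subst n; case: c vc ex cn e ej => [b|] /= vb ex cn e ej.
    by move: ex e; rewrite vb => -[<-]; rewrite /ext /inA /in_var /= eqxx.
  by have [_] := interaction_ptr ex; rewrite ej.
move: ej' ey cj; rewrite ej => -[<-] ey cj; exists c, y; split=> //.
have [y' ey' py'] : exists2 y, mv u j = Some y & isPC c y.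
  by apply: (just_isPC vc ex cn _ ej cj); rewrite (isPC_ext vc ex cn e).
by move: py'; rewrite ey in ey'; case: ey' => ->.
Qed.

(** At a hidden O-move of [c] the P-view jumps to the justifier while the trail keeps walking. But
    this move is a P-move of another component, whose visibility puts the justifier in the P-view of
    that component, hence on the trail by induction. *)
Lemma view_trail n c x k' : valid c -> mv u n = Some x -> inC c n -> isPC c x ->
  view true (playC c) (rank_in (inC c) n) k' ->
  exists k, [/\ inC c k, k' = rank_in (inC c) k & trail n k].
Proof.
elim/ltn_ind: n c x k' => n IH c x k' vc ex cn px.
have [m [y [en ey cm py]]] := component_pred vc ex cn px; subst n.
case/(view_restrictS cm) => y'; rewrite ey => -[<-] [ek|[[py' _]|[_ [j [ej cj h]]]]].
- by exists m; split=> //; apply: trail_last ey.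
- by move: py; rewrite /isPC py'.
have [z ez pz] := just_isPC vc ey cm py ej cj; have ltj := justified_lt ju ej.
have oz := isPC_not_extO vc ez cj pz.
have tj : trail m.+1 j.
  case o: (extO y); first exact: trail_just ey o ej.
  have [d [vd dm pd]] := P_component ey (negbT o).
  apply: (trail_step ey (negbT o)).
  have dj : inC d j.
    have ne : m <> initC d by move=> e; rewrite e in ey; move: (isPC_initC vd ey); rewrite pd.
    have [j' [w [ej' _ _ _ dj']]] := component_just vd ey dm ne; by move: ej' dj'; rewrite ej => -[<-].
  have [_ _ vis _] := plays vd.
  have := vis _ _ (rank_in (inC d) j) (mv_restrict _ ey dm).
  rewrite -/(isPC d y) pd ptr_restrict ?(mv_size ey) // ej /= reindexT // => /(_ erefl) v.
  have [k [dk ek t]] := IH m (leqnn _) d y _ vd ey dm pd v.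
  by rewrite (rank_in_inj dj dk ek).
case: h => [->|v]; first by exists j.
have [k [ck ek t]] := IH j (ltnW ltj) c z _ vc ez cj pz v.
by exists k; split=> //; apply: trail_trans tj ez oz t.
Qed.

Lemma P_just c n x : valid c -> mv u n = Some x -> inC c n -> isPC c x ->
  exists j, [/\ ptr u n = Some j, j < n, inC c j & trail n j].
Proof.
move=> vc ex cn px.
have ne : n <> initC c by move=> e; rewrite e in ex; move: (isPC_initC vc ex); rewrite px.
have [j [y [ej lt _ _ cj]]] := component_just vc ex cn ne; exists j; split=> //.
have [_ _ vis _] := plays vc.
have := vis _ _ (rank_in (inC c) j) (mv_restrict _ ex cn).
rewrite -/(isPC c x) px ptr_restrict ?(mv_size ex) // ej /= reindexT // => /(_ erefl) v.
have [k [ck ek t]] := view_trail vc ex cn px v.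
by rewrite (rank_in_inj cj ck ek).
Qed.

(** * Incremental justification along the trail *)

Hypothesis incrs : forall c, valid c -> incremental (tyC c) (playC c).

Lemma component_incremental c n x j k y : valid c -> mv u n = Some x -> inC c n -> isPC c x ->
  ptr u n = Some j -> inC c j -> inC c k ->
  view true (playC c) (rank_in (inC c) n) (rank_in (inC c) k) ->
  j < k -> mv u k = Some y -> ~~ isPC c y -> y.2.2 = None -> iord y < irank x.
Proof.
move=> vc ex cn px ej cj ck v lt ey py qy.
have ne : n <> initC c by move=> e; rewrite e in ex; move: (isPC_initC vc ex); rewrite px.
have ne' : k <> initC c.
  by move=> e; subst k; move: (inC_init cj) lt; lia.
have ep : ptr (playC c) (rank_in (inC c) n) = Some (rank_in (inC c) j).
  by rewrite ptr_restrict ?(mv_size ex) // ej /= reindexT.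
have e : moveC c y = ((moveC c y).1, None) by rewrite -qy -(moveC2 c); case: (moveC c y).
have ey' : mv (playC c) (rank_in (inC c) k) = Some ((moveC c y).1, None).
  by rewrite (mv_restrict _ ey ck) -e.
have lt' : rank_in (inC c) j < rank_in (inC c) k by rewrite rank_in_ltE.
have := incrs vc (mv_restrict _ ex cn) px ep v lt' ey'.
rewrite (ordat_moveC vc ey ck ne' qy) /irank /rank moveC2.
have -> : odd (size (moveC c y).1) = isPC c y.
  by rewrite /isPC /is_P moveC2 qy addbF.
move=> /(_ py); case qx: x.2.2 => //.
by rewrite (ordat_moveC vc ex cn ne qx).
Qed.

(* A hidden O-move of a component is a P-move of another one, so the segment of
   the trail above its justifier is bounded by induction. *)
Lemma trail_bound n c x j R : valid c -> mv u n = Some x -> inC c n -> isPC c x -> inC c j ->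
  (forall k y, inC c k -> view true (playC c) (rank_in (inC c) n) (rank_in (inC c) k) ->
     j < k -> mv u k = Some y -> ~~ isPC c y -> y.2.2 = None -> iord y < R) ->
  forall e y, trail n e -> j < e -> mv u e = Some y -> extO y -> y.2.2 = None -> iord y < R.
Proof.
elim/ltn_ind: n c x j R => n IH c x j R vc ex cn px cj bnd e y t lt ey oy qy.
have [m [z [en ez cm pz]]] := component_pred vc ex cn px; subst n.
have vm : view true (playC c) (rank_in (inC c) m.+1) (rank_in (inC c) m).
  exact: view_restrict_last (mv_size ez) cm.
(* When [e] lies on the trail of the justifier [j1], the induction restarts there with the same
   bound, as the P-view of [c] at [j1] is part of the one at [m.+1]. *)
have back j1 w : ptr u m = Some j1 -> inC c j1 -> mv u j1 = Some w -> isPC c w ->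
    trail j1 e -> iord y < R.
  move=> ej1 cj1 ew pw te; apply: (IH j1 _ c w j R vc ew cj1 pw cj _ e y te) => //.
    exact: ltnW (justified_lt ju ej1).
  move=> k v ck vk; apply: bnd => //.
  by apply: (view_restrict_other ez cm _ ej1 cj1 vk); apply: negbTE.
case o: (extO z).
  case: (trailS t ez) => [ee|[[]|[_ [j1 ej1 h]]]]; [|by rewrite o|].
    subst e; move: ey; rewrite ez => -[ey]; subst z.
    exact: (bnd m y).
  have [d [w [vd dm dj ew pw]]] := extO_just ez o ej1.
  have /andP[ez' _] := o; have [d' [_ _ ud]] := ext_component ez ez'.
  rewrite (ud _ vd dm) -(ud _ vc cm) in dj pw.
  case: h => [ee|te]; last exact: back ej1 dj ew pw te.
  by subst e; move: (isPC_not_extO vc ew dj pw); move: ey; rewrite ew => -[->]; rewrite oy.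
have [d [vd dm pd]] := P_component ez (negbT o).
have [j1 [ej1 lt1 dj1 tj1]] := P_just vd ez dm pd.
case: (trailS t ez) => [ee|[[_ te]|[]]]; [|  |by rewrite o].
  by subst e; move: ey o; rewrite ez => -[->]; rewrite oy.
have ltem := trail_lt te.
case: (ltnP j1 e) => [lt1e|].
  (* As a P-move of [d], [z] bounds the segment above [j1] by its rank; as an O-question in the
     P-view of [c], it is itself below [R]. An answer [z] has rank 0, so its segment contains no
     visible O-question. *)
  have lt' : iord y < irank z.
    apply: (IH m _ d z j1 (irank z) vd ez dm pd dj1 _ e y te) => //.
    by move=> k v dk vk l ev pv qv; apply: component_incremental ej1 dj1 dk vk l ev pv qv.
  move: lt'; rewrite /irank; case qz: z.2.2 => [//|] l.
  by apply: leq_trans (bnd m z cm vm _ ez pz qz) => //; apply: ltn_trans ltem.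
move=> le.
have cj1 : inC c j1.
  have ne : m <> initC c by move=> em; have := inC_init cj; lia.
  have [j2 [w [ej2 _ _ _ cj2]]] := component_just vc ez cm ne.
  by move: ej2 cj2; rewrite ej1 => -[->].
have [w ew pw] := just_isPC vc ez cm pz ej1 cj1.
have ow := isPC_not_extO vc ew cj1 pw.
move: le; rewrite leq_eqVlt => /predU1P[ee|l].
  by subst e; move: ey ow; rewrite ew => -[->]; rewrite oy.
exact: back ej1 cj1 ew pw (trail_linear tj1 ew ow te l).
Qed.

Lemma trail_incremental n c x j : valid c -> mv u n = Some x -> inC c n -> isPC c x ->
  ptr u n = Some j ->
  forall e y, trail n e -> j < e -> mv u e = Some y -> extO y -> y.2.2 = None -> iord y < irank x.
Proof.
move=> vc ex cn px ej; have [j' [ej' _ cj _]] := P_just vc ex cn px.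
move: ej'; rewrite ej => -[ejj]; subst j'.
apply: trail_bound (vc) (ex) (cn) (px) (cj) _ => k v ck vk l ev pv qv.
exact: component_incremental ej cj ck vk l ev pv qv.
Qed.

Lemma hide_view n k : n <= size u -> view true (hide G u) (rank_in inExt n) k ->
  exists k', [/\ inExt k', k = rank_in inExt k' & trail n k'].
Proof.
elim/ltn_ind: n k => n IH k; case: n IH => [|n] IH le; first by move/view0.
have [x ex] := size_mv le.
case en: (inExt n); last first.
  rewrite rank_inS en addn0 => /(IH n (leqnn _) _ (ltnW le)) [k' [ek ? t]]; exists k'; split=> //.
  by apply: (trail_step ex _ t); rewrite /extO -(holds_mv _ ex) -/(inExt n) en.
have e : ext G x by move: en; rewrite /inExt (holds_mv _ ex).
have ex' : mv (shortcut G u) n = Some x by rewrite mv_shortcut.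
rewrite hide_restrict => /(view_restrictS en) [y]; rewrite ex' => -[<-]; rewrite is_P_ext_move.
case=> [->|[[px v]|[px [j [ej jn h]]]]].
- by exists n; split=> //; apply: trail_last ex.
- have [k' [ek ? t]] := IH n (leqnn _) _ (ltnW le) v; exists k'; split=> //.
  by apply: (trail_step ex _ t); rewrite /extO px andbF.
have o : extO x by rewrite /extO e px.
(* [shortcut] leaves the pointers of visible O-moves alone: a visible move justified by a hidden one
   is a call of a variable, hence a P-move. *)
have ej' : ptr u n = Some j.
  move: ej; rewrite ptr_shortcut; case ej0: (ptr u n) => [j0|] //=.
  case: ifP => // hid; have [c [w [vc cn cj0 ew pw]]] := extO_just ex o ej0.
  have := interaction_ptr ex; case: (n) ej0 => [|n'] ej0; first by rewrite ej0 => -[].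
  case=> k1 [y1 [ek1 _ ey1 en1]]; move: ek1 ey1; rewrite ej0 => -[<-]; rewrite ew => -[e1]; subst y1.
  have hw : inA G w by move: hid; rewrite (holds_mv _ ew).
  have nx : x <> initialA D G.
    by move=> ei; move: e; rewrite ei /ext /inA /in_var /= eqxx.
  have := ienables_threaded en1 nx; rewrite /threaded hw orbT.
  have -> : inA G x = false by apply/negbTE.
  rewrite orbF; case: (w) hw en1 => [[] m'] // _; case: (x) px => [[] m] //= pm.
  by case=> _ [i _ em]; move: pm; rewrite em.
case: h => [->|v]; first by exists j; split=> //; apply: trail_just ex o ej'.
have lt := justified_lt ju ej'.
have [k' [ek ? t]] := IH j (ltnW lt) _ (ltnW (ltn_trans lt le)) v.
by exists k'; split=> //; apply: trail_jump ex o ej' t.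
Qed.

Lemma ordat_ext_move n x : mv u n = Some x -> ext G x -> 0 < n -> x.2.2 = None ->
  ordat (closeT G B) (ext_move G x).1 = iord x.
Proof.
move=> ex e n0 qx.
have var T1 T2 j r : j < p -> ordat (closeT G T1) (j :: r) = ordat (closeT G T2) (j :: r).
  rewrite -onthTE; case ej: (onth G j) => [[z C]|] // _.
  by rewrite /ordat !(subty_closeT_var _ _ ej).
case: x ex e qx => [[] [r o]] ex e /= qx; subst o; rewrite /iord /ext_move /=.
  case: r ex e => [|j r] ex; first by have := interaction_root ex erefl; move: n0; case: (n).
  rewrite /ext /inA /in_var /= => ne; have {}ne : j != p by apply: contraNneq ne => ->.
  case: ltnP => [lt|le]; last by apply: var; rewrite ltn_neqAle ne.
  rewrite /ordat subty_closeT_concl' -/p; last by lia.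
  rewrite subty_closeT_concl' -/p; last by lia.
  by have -> : j - p = (j.-1 - p).+1 by lia.
have [j [r' [/= -> lt]]] := interaction_false_head ex.
by rewrite ltnNge (ltnW lt) /=; apply: var.
Qed.

Hypothesis thread_vars : forall b i, valid (Some b) -> i < p ->
  (exists n, mv (thread G u b) n = Some ([:: i], None)) ->
  exists x C, onth G i = Some (x, C) /\ ord A <= ord C.

Lemma hide_incremental : incremental (closeT G B) (hide G u).
Proof.
move=> i m k e q em pm ek v lt eq sq.
have [n [x [ex en ei emx]]] := mv_restrictP em; subst i m.
rewrite mv_shortcut in ex; rewrite is_P_ext_move in pm.
have n0 : 0 < n by case: (n) ex => [/interaction_ptr [e0]|//]; rewrite e0 in pm.
have [e' [ee ? t]] := hide_view (ltnW (mv_size ex)) v; subst e.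
have [y ey] := size_mv (ltn_trans (trail_lt t) (mv_size ex)).
have ey' : mv (shortcut G u) e' = Some y by rewrite mv_shortcut.
move: eq; rewrite hide_restrict (mv_restrict _ ey' ee) => /Some_inj eq.
have exy : ext G y by move: ee; rewrite /inExt (holds_mv _ ey).
have exx : ext G x by move: en; rewrite /inExt (holds_mv _ ex).
have qy : y.2.2 = None by move: eq; rewrite /ext_move => -[].
have oy : extO y.
  by rewrite /extO exy -is_P_ext_move eq /is_P /= addbF.
have e0 : 0 < e' by case: (e') lt.
have -> : q = (ext_move G y).1 by rewrite eq.
have -> : rank (closeT G B) (ext_move G x) = irank x.
  rewrite /rank /irank [(ext_move G x).2]/=.
  by case qx: x.2.2 => //; rewrite (ordat_ext_move ex exx n0 qx).
rewrite (ordat_ext_move ey exy e0 qy).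
have [c [vc cn px]] : exists c, [/\ valid c, inC c n & isPC c x].
  by apply: P_component ex _; rewrite /extO pm andbF.
have [j [ej ltj cj tj]] := P_just vc ex cn px.
have ex' : mv (shortcut G u) n = Some x by rewrite mv_shortcut.
move: ek; rewrite hide_restrict ptr_restrict ?(mv_size ex') // ptr_shortcut ej /=.
case: ifP => hid; last first.
  rewrite /= /Defs.reindex -/(rank_in inExt j); case: ifP => // jE [ekj].
  move: lt; rewrite -ekj rank_in_ltE // => lt.
  exact: trail_incremental vc ex cn px ej _ _ t lt ey oy qy.
have [w ew hw] := holdsP hid.
have [ewi [C [a [l [eC [lC exi]]]]]] : w = initialA D G /\ exists C a l,
    onth G l = Some (a, C) /\ ord A <= ord C /\ x = (false, ([:: l], None)).
  have := interaction_ptr ex; case: (n) n0 ej ex cn => // n' _ ej ex2 cn [k1 [y1 [ek1 _ ey1 en1]]].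
  move: ek1 ey1; rewrite ej => -[<-]; rewrite ew => -[ey1]; subst y1.
  have nx : x <> initialA D G.
    by move=> ei; move: exx; rewrite ei /ext /inA /in_var /= eqxx.
  have := ienables_threaded en1 nx; rewrite /threaded hw orbT.
  have -> : inA G x = false by apply/negbTE.
  rewrite orbF => xf; move: en1.
  case: (w) hw => [[] m'] // _; case: (x) xf ex2 cn => [[] m] //= _ ex2 cn.
  case=> -> [l ltl eml]; subst m; split=> //.
  case: c vc cn px cj => [b|] vc cn px _; last by move: cn; rewrite (inC_None ex2).
  have [|a [C [ea lC]]] := thread_vars vc ltl; last by exists C, a, l.
  by exists (rank_in (inC (Some b)) n'.+1); apply: (mv_restrict _ ex2 cn).
subst w; rewrite (interaction_initialA ew) /=.
rewrite /Defs.reindex; case: ifP => // _ [ek]; subst k.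
have -> : irank x = (ord C).+1.
  by rewrite exi /irank /= /iord /ordat (subty_closeT_var _ _ eC).
have io : irank (initialA D G) = (ord A).+1.
  rewrite /irank /iord /ordat [X in subty _ X]/= -/p.
  by rewrite (@subty_closeT_concl' G (Arr A B)) // subnn.
have ne : ~~ extO (initialA D G) by rewrite /extO /ext /inA /in_var /= eqxx.
(* Above [j] the bound comes from the move itself. Below [j] it comes from the initial move of [A]
   at [j], a P-move of sigma pointing to the root, and [ord A <= ord C] transfers it. *)
case: (ltngtP j e') => [l1|l1|l1].
- have := trail_incremental vc ex cn px ej t l1 ey oy qy.
  by rewrite exi /irank /= /iord /ordat (subty_closeT_var _ _ eC).
- have t' := trail_linear tj ew ne t l1.
  have cj' : inC None j by rewrite (inC_None ew).
  have := @trail_incremental j None (initialA D G) 0 I ew cj' erefl (interaction_initialA ew) _ _ t' e0 ey oy qy.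
  by rewrite io => l2; apply: leq_trans l2 _.
by subst e'; move: ey oy ne; rewrite ew => -[<-] ->.
Qed.
End Interaction.

Lemma compose_incremental D G A B (sigma tau : strategy D) :
  (forall s, sigma s -> play (closeT G (Arr A B)) s /\ incremental (closeT G (Arr A B)) s) ->
  (forall s, tau s -> play (closeT G A) s /\ incremental (closeT G A) s) ->
  (forall s i, tau s -> i < size G -> (exists n, mv s n = Some ([:: i], None)) ->
     exists x C, onth G i = Some (x, C) /\ ord A <= ord C) ->
  forall s, compose G A B sigma tau s -> play (closeT G B) s /\ incremental (closeT G B) s.
Proof.
move=> hs ht hv s [ps [u [ju su tu es]]]; split=> //; subst s.
have pl c : valid G u c -> play (tyC G A B c) (playC G u c).
  by case: c => [b /tu /ht []|_] //; case: (hs _ su).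
have inc c : valid G u c -> incremental (tyC G A B c) (playC G u c).
  by case: c => [b /tu /ht []|_] //; case: (hs _ su).
apply: hide_incremental ju pl _ inc _; first by case: ps.
by move=> b i /tu; apply: hv.
Qed.

(** Hiding erases only moves of [A], so each visible call of a variable stems from sigma or from one
    thread of tau. *)
Lemma compose_vars D G A B (sigma tau : strategy D) s i :
  compose G A B sigma tau s -> i < size G -> (exists n, mv s n = Some ([:: i], None)) ->
  exists s', (sigma s' \/ tau s') /\ exists n, mv s' n = Some ([:: i], None).
Proof.
move=> [ps [u [ju su tu es]]] lt [n en]; rewrite es in en.
have [k [x [ex Kk _ em]]] := mv_restrictP en.
rewrite mv_shortcut in ex.
have {}em : x.2 = ([:: i], None).
  case: x em {ex} => b [[|j r] o] //= [ei <- <-].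
  by move: ei; case: (ltnP (size G) j) => [l|_ <- //]; lia.
case x1: x.1.
  exists (projM u); split; [by left | exists (rank_in (holds (@inM D) u) k)].
  by rewrite /projM (mv_restrict _ ex) ?em // (holds_mv _ ex).
have := thread_unique ju ex; rewrite /threaded x1 /= => -[b mb h].
exists (thread G u b); split; [by right; apply: tu | exists (rank_in (hereditary u b) k)].
rewrite /thread (mv_restrict _ ex) ?h //; congr Some.
by rewrite /thread_move x1 em.
Qed.

(** * Copycat *)

Lemma rank_in_leq (K : pred nat) i j : i <= j -> rank_in K i <= rank_in K j.
Proof. by move=> le; rewrite /rank_in -(subnKC le) iotaD count_cat leq_addr. Qed.

Lemma onth_take T (s : seq T) n k : onth (take n s) k = if k < n then onth s k else None.
Proof.
elim: s n k => [|x s IH] [|n] [|k] //=; first by rewrite if_same.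
by rewrite IH.
Qed.

(** Pointers go backwards, so renumbering them only counts positions inside the prefix. *)
Lemma restrict_take X Y (P : X -> bool) (f : X -> Y) (s : jseq X) n :
  (forall i k, ptr s i = Some k -> k < i) -> n <= size s ->
  restrict (holds P (take n s)) f (take n s)
  = take (rank_in (holds P s) n) (restrict (holds P s) f s).
Proof.
move=> js le.
have eh j : j < n -> holds P (take n s) j = holds P s j.
  by move=> lt; rewrite /holds /mv onth_take lt.
have er k : k < n -> reindex (holds P (take n s)) k = reindex (holds P s) k.
  move=> lt; rewrite /Defs.reindex eh //; congr (if _ then Some _ else _).
  by apply: rank_in_eq => l ll; apply: eh; apply: ltn_trans ll lt.
rewrite -(rank_in_restrict (holds P s) f le) /restrict size_takel //.
have -> : iota 0 (size s) = iota 0 n ++ iota n (size s - n) by rewrite -{1}(subnKC le) iotaD.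
rewrite pmap_cat take_size_cat; last by rewrite size_pmap.
apply: eq_in_pmap => i; rewrite mem_iota /= add0n => lt.
rewrite eh //; case: (holds P s i) => //; rewrite onth_take lt.
case ei: (onth s i) => [[x [k|]]|] //=; rewrite er //.
by apply: ltn_trans lt; apply: js; rewrite (onth_ptr ei).
Qed.

Section Copycat.
Variables (D : Type) (G : ctx) (i x0 : nat) (A : ty) (s : jseq (move D)).
Hypothesis Gi : onth G i = Some (x0, A).
Hypothesis cs : copycat G i A s.
Let p := size G.
Let Kv := holds (in_var i) s.
Let Kc := holds (in_concl p) s.
Let Rv := restrict Kv (@var_move D) s.
Let Rc := restrict Kc (concl_move p) s.

Let pl : play (closeT G A) s. Proof. by case: cs. Qed.
Let js : justified (@initial D) (enables (closeT G A)) s. Proof. by case: pl. Qed.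

Lemma copycat_parity n m : mv s n = Some m -> is_P m = odd n.
Proof. by have [_ al _ _] := pl; apply: al. Qed.

Lemma copycat_just n m : mv s n = Some m -> 0 < n ->
  exists k m', [/\ ptr s n = Some k, k < n, mv s k = Some m' & enables (closeT G A) m' m].
Proof. by move=> em; have := justified_ptr js em; case: (n). Qed.

Lemma copycat_take n : n <= size s -> ~~ odd n -> take (rank_in Kv n) Rv = take (rank_in Kc n) Rc.
Proof.
move=> le en; have [_ /(_ n le en)] := cs => /=.
have lt k j : ptr s k = Some j -> j < k by apply: justified_lt js.
by rewrite !restrict_take.
Qed.

Lemma copycat_rank n : n <= size s -> ~~ odd n -> rank_in Kv n = rank_in Kc n.
Proof.
move=> le en; have := congr1 size (copycat_take le en).
by rewrite !size_takel // size_restrict; apply: rank_in_leq.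
Qed.

Lemma copycat_disjoint n : ~~ (Kv n && Kc n).
Proof.
apply/negP => /andP[].
rewrite /Kv /Kc /holds /in_var /in_concl; case: (mv s n) => [[[|j r] o]|] //= /eqP [->].
by rewrite leqNgt -onthTE Gi.
Qed.

Lemma enables_in_concl (m m' : move D) : enables (closeT G A) m m' -> in_concl p m' -> in_concl p m.
Proof.
by case: m => r o [/= _ _ [[j ->]|[v ->]]]; case: r.
Qed.

Lemma enables_in_var (m m' : move D) : enables (closeT G A) m m' -> in_var i m' ->
  in_var i m \/ m = ([::], None) /\ m' = ([:: i], None).
Proof.
case: m => r o [/= -> _ [[j ->]|[v ->]]]; rewrite /in_var; last by left.
by case: r => [|a r] /= h; [right; case/eqP: h => -> | left].
Qed.

Lemma enables_sides (m m' : move D) : enables (closeT G A) m m' -> is_P m ->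
  (in_var i m -> in_var i m') /\ (in_concl p m -> in_concl p m').
Proof.
case: m => r o [/= -> _ [[j ->]|[v ->]]] //; rewrite /in_var.
by case: r => [|a r] //=.
Qed.

(** A later O-move points to a P-move, which is not the root, and so stays on the side of its
    justifier. Equality of the two restrictions at even lengths then forces the reply of P onto the
    other side. *)
Lemma copycat_cover n : n.*2 <= size s ->
  [/\ rank_in Kv n.*2 = n, rank_in Kc n.*2 = n & forall k, k < n.*2 -> Kv k || Kc k].
Proof.
elim: n => [|n IH] le; first by split.
rewrite doubleS in le *; have [rv rc cov] := IH (ltnW (ltnW le)).
have [m em] := size_mv (ltnW le).
have cov2 : Kv n.*2 || Kc n.*2.
  rewrite /Kv /Kc !(holds_mv _ em).
  case: n {IH rv rc} em cov le => [|n] em cov le.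
    by have [-> _] := justified_ptr js em; rewrite orbT.
  have [|k [m' [ek lt ek' en]]] := copycat_just em; first by rewrite double_gt0.
  have pm' : is_P m' by have := enables_is_P en; rewrite (copycat_parity em) odd_double; case: is_P.
  have [h1 h2] := enables_sides en pm'.
  by have := cov _ lt; rewrite /Kv /Kc !(holds_mv _ ek') => /orP[/h1|/h2] ->; rewrite ?orbT.
have := @copycat_rank n.*2.+2 le; rewrite /= negbK odd_double => /(_ isT).
rewrite !rank_inS rv rc.
have d1 := @copycat_disjoint n.*2; have d2 := @copycat_disjoint n.*2.+1.
move=> e; split.
- by move: e d1 d2 cov2; case: (Kv n.*2); case: (Kc n.*2); case: (Kv n.*2.+1); case: (Kc n.*2.+1) => //=; lia.
- by move: e d1 d2 cov2; case: (Kv n.*2); case: (Kc n.*2); case: (Kv n.*2.+1); case: (Kc n.*2.+1) => //=; lia.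
move=> k; rewrite ltnS leq_eqVlt ltnS leq_eqVlt => /or3P[/eqP->|/eqP->|/cov//] //.
by move: e d1 d2 cov2; case: (Kv n.*2); case: (Kc n.*2); case: (Kv n.*2.+1); case: (Kc n.*2.+1) => //=; lia.
Qed.

Lemma copycat_pair n : n.*2.+1 < size s ->
  Kv n.*2.+1 && Kc n.*2 || Kc n.*2.+1 && Kv n.*2.
Proof.
move=> lt; have [rv rc _] := copycat_cover (ltnW (ltnW lt)).
have := @copycat_cover n.+1; rewrite doubleS => /(_ lt) [rv' rc' cov].
move: rv' rc'; rewrite !rank_inS rv rc.
have := cov n.*2; have := cov n.*2.+1; rewrite !ltnS leqnn leqnSn => /(_ isT) + /(_ isT).
by case: (Kv n.*2); case: (Kc n.*2); case: (Kv n.*2.+1); case: (Kc n.*2.+1) => //=; lia.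
Qed.

Lemma copycat_onth n : n.*2.+1 < size s -> onth Rv n = onth Rc n.
Proof.
move=> lt; have := @copycat_take n.*2.+2 lt; rewrite /= negbK odd_double => /(_ isT).
have := @copycat_cover n.+1; rewrite doubleS => /(_ lt) [-> -> _] e.
by have := congr1 (fun r => onth r n) e; rewrite !onth_take ltnSn.
Qed.

Lemma rank_in_half (K : pred nat) l : K l -> rank_in K l./2.*2 = l./2 ->
  (K l./2.*2 -> ~~ odd l) -> rank_in K l = l./2.
Proof.
move=> Kl; case: (boolP (odd l)) => ol; last first.
  have e : l./2.*2 = l by rewrite -{2}(odd_double_half l) (negPf ol).
  by rewrite e.
have e : l = l./2.*2.+1 by rewrite -{1}(odd_double_half l) ol.
by move=> r h; rewrite {1}e rank_inS r; case: (K _) h => [/(_ isT)//|]; rewrite addn0.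
Qed.

Lemma copycat_rank_half l : l < size s ->
  (Kv l -> rank_in Kv l = l./2) /\ (Kc l -> rank_in Kc l = l./2).
Proof.
move=> lt; have [|rv rc _] := @copycat_cover l./2; first by lia.
have odd_case : odd l -> Kv l && Kc l./2.*2 || Kc l && Kv l./2.*2.
  move=> ol; have e : l = l./2.*2.+1 by rewrite -{1}(odd_double_half l) ol.
  by have := @copycat_pair l./2; rewrite -e => /(_ lt).
have d1 := copycat_disjoint l; have d2 := copycat_disjoint l./2.*2.
split=> Kl; apply: rank_in_half => // Kl'; apply/negP => /odd_case; move: d1 d2; rewrite Kl Kl'.
  by case: (Kc l); case: (Kc _).
by case: (Kv l); case: (Kv _).
Qed.

Lemma copycat_root n o : mv s n = Some ([::], o) -> o = None -> n = 0.
Proof.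
move=> em eo; move: em; rewrite {}eo; case: n => // n em.
have [k [m [_ _ _ [_ _]]]] := copycat_just em isT.
by case=> [[j []]|[v []]] //; case: m.1.
Qed.

Lemma ordat_var_move (m : move D) : in_var i m -> ordat (closeT G A) m.1 = ordat A (var_move m).1.
Proof.
case: m => [[|j r] o] //= /eqP[->]; rewrite /ordat /=.
by rewrite -/(subty _ (i :: r)) (subty_closeT_var _ _ Gi).
Qed.

Lemma ordat_concl_move (m : move D) : in_concl p m -> m.1 <> [::] ->
  ordat (closeT G A) m.1 = ordat A (concl_move p m).1.
Proof. by case: m => [[|j r] o] // le _; rewrite /ordat subty_closeT_concl'. Qed.

(* In each pair (2n, 2n+1) one move copies the other, pointers included. *)
Lemma copycat_copy n m m' k : mv s n.*2 = Some m -> mv s n.*2.+1 = Some m' ->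
  ptr s n.*2.+1 = Some k -> 0 < n ->
  [/\ m'.2 = m.2, ptr s n.*2 = Some k.+1 &
      m.2 = None -> ordat (closeT G A) m.1 = ordat (closeT G A) m'.1].
Proof.
move=> em em' ek n0; have lt' := mv_size em'; have lt := mv_size em.
have nr : m <> ([::], None).
  by move=> e; rewrite e in em; have := copycat_root em erefl; case: (n) n0.
have [k' [mk [ek' ltk emk enk]]] := copycat_just em' isT.
move: ek'; rewrite ek => -[e]; subst k'.
have ok : ~~ odd k.
  have := enables_is_P enk; rewrite (copycat_parity em') (copycat_parity emk) /= odd_double.
  by case: odd.
have [j [mj [ej ltj emj enj]]] : exists k m', [/\ ptr s n.*2 = Some k, k < n.*2, mv s k = Some m' & enables (closeT G A) m' m].
  by apply: copycat_just => //; rewrite double_gt0.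
have oj : odd j.
  have := enables_is_P enj; rewrite (copycat_parity em) (copycat_parity emj) /= odd_double.
  by case: odd.
(* By polarity [k] is even and [j] is odd; with equal indices in their sides they form one pair. *)
have half : k./2 = j./2 -> j = k.+1.
  move=> h; rewrite -(odd_double_half j) -(odd_double_half k) h oj (negPf ok).
  by [].
have rn := copycat_rank_half lt; have rn' := copycat_rank_half lt'.
have rj := copycat_rank_half (mv_size emj); have rk := copycat_rank_half (mv_size emk).
have n2 : n.*2./2 = n by rewrite doubleK.
have n2' : n.*2.+1./2 = n by rewrite -[RHS]n2; lia.
have := copycat_onth lt'.
case/orP: (copycat_pair lt') => /andP[h1 h2].
- have onV := onth_restrict (@var_move D) (mv_onth em') h1.
  have onC := onth_restrict (concl_move p) (mv_onth em) h2.
  rewrite (proj1 rn' h1) n2' ek in onV; rewrite (proj2 rn h2) n2 ej in onC.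
  rewrite /Rv /Rc onV onC => /Some_inj /pair_equal_spec [c1 c2].
  have m'v : in_var i m' by move: h1; rewrite /Kv (holds_mv _ em').
  have mc : in_concl p m by move: h2; rewrite /Kc (holds_mv _ em).
  have qq : m'.2 = m.2 by have := congr1 snd c1.
  have mk_v : in_var i mk.
    case: (enables_in_var enk m'v) => // -[_ em1]; case: nr; move: c1; rewrite em1.
    by case: (m) => [[|a r] o] //= [<-].
  have Kk : Kv k by rewrite /Kv (holds_mv _ emk).
  split=> //.
    move: c2; rewrite /= (reindexT Kk) (proj1 rk Kk) /Defs.reindex -/(rank_in Kc j).
    by case: ifP => // Kj [e]; rewrite ej (half _) // e (proj2 rj Kj).
  move=> qm; rewrite ordat_concl_move //; last by move=> e; apply: nr; move: e qm; case: (m) => a b /= -> ->.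
  by rewrite ordat_var_move // c1.
have onV := onth_restrict (@var_move D) (mv_onth em) h2.
have onC := onth_restrict (concl_move p) (mv_onth em') h1.
rewrite (proj1 rn h2) n2 ej in onV; rewrite (proj2 rn' h1) n2' ek in onC.
rewrite /Rv /Rc onV onC => /Some_inj /pair_equal_spec [c1 c2].
have mv' : in_var i m by move: h2; rewrite /Kv (holds_mv _ em).
have m'c : in_concl p m' by move: h1; rewrite /Kc (holds_mv _ em').
have qq : m.2 = m'.2 by have := congr1 snd c1.
have Kk : Kc k by rewrite /Kc (holds_mv _ emk); apply: enables_in_concl enk m'c.
split=> //.
  move: c2; rewrite /= (reindexT Kk) (proj2 rk Kk) /Defs.reindex -/(rank_in Kv j).
  by case: ifP => // Kj [e]; rewrite ej (half _) // -e (proj1 rj Kj).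
move=> qm; rewrite [RHS]ordat_concl_move //.
  by rewrite ordat_var_move // c1.
move=> e; have := copycat_parity em'; rewrite /is_P e -qq qm /= odd_double.
by [].
Qed.

(** If a P-move points to [k], the O-move just before it points to [k.+1], so the P-view passes from
    that O-move directly to the P-move at [k.+1]. Above [k] only the copied move can be an
    O-question, and it has the same order. *)
Lemma copycat_incremental : incremental (closeT G A) s.
Proof.
move=> n m' k e q em' pm' ek v lt eq sq.
have on : odd n by rewrite -(copycat_parity em').
have en : n = n./2.*2.+1 by rewrite -{1}(odd_double_half n) on.
move: (n./2) en => h en; subst n.
have sz := mv_size em'.
have [m em] := size_mv (ltnW sz).
have pe := copycat_parity eq; rewrite /is_P /= addbF (negPf sq) in pe.
have ltk := justified_lt js ek.
case/viewS: v => m1; rewrite em => -[<-].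
rewrite (copycat_parity em) odd_double; case=> [ee|[[//]|[_ [j ej hj]]]].
  subst e; have h0 : 0 < h by case: (h) lt.
  have [e2 _ e1] := copycat_copy em em' ek h0.
  move: eq e1 e2; rewrite em => -[->] /= /(_ erefl) -> e2.
  by rewrite /rank e2.
have h0 : 0 < h.
  by case: (h) ej em => // ej; move/(justified_ptr js) => [_]; rewrite ej.
have [_ ej' _] := copycat_copy em em' ek h0.
move: ej' hj; rewrite ej => -[->] [ee|v]; last by have := view_lt pl v; lia.
subst e; move: pe; rewrite /= => /esym /negbFE ok.
have [m2 [em2 en2]] : exists m2, mv s k = Some m2 /\ enables (closeT G A) m2 m'.
  by have [k' [m2 [ek' _ em2 en2]]] := copycat_just em' isT; exists m2; move: ek'; rewrite ek => -[->].
have := enables_is_P en2; rewrite pm' (copycat_parity em2) ok //.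
Qed.

Lemma copycat_vars l : l < p -> (exists n, mv s n = Some ([:: l], None)) -> l = i.
Proof.
move=> lt [n en].
have on : odd n by rewrite -(copycat_parity en).
have e2 : n = n./2.*2.+1 by rewrite -{1}(odd_double_half n) on.
move: (n./2) e2 => h e2; subst n.
have := @copycat_cover h.+1; rewrite doubleS => /(_ (mv_size en)) [_ _ /(_ _ (leqnn _))].
rewrite /Kv /Kc !(holds_mv _ en) /in_var /in_concl /= => /orP[/eqP[]//|].
by rewrite leqNgt lt.
Qed.
End Copycat.

(** * Safe terms denote incrementally justified strategies *)

Lemma lookup_onth (G : ctx) x i A : lookup G x = Some (i, A) -> onth G i = Some (x, A).
Proof.
elim: G i => //= [[y B] G] IH i; case e: (lookup G x) => [[j C]|].
  by case=> <- eA; rewrite eA in e; apply: IH.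
by case: eqP => // -> [<- <-].
Qed.

Lemma lookup_None (G : ctx) x : x \notin unzip1 G -> lookup G x = None.
Proof.
elim: G => //= [[y B] G] IH; rewrite inE negb_or => /andP[/negPf-> /IH->] //.
Qed.

Lemma lookup_cat (G H : ctx) x : lookup (G ++ H) x =
  if lookup H x is Some (i, A) then Some (size G + i, A) else lookup G x.
Proof.
elim: G => [|[y B] G IH] /=; first by case: (lookup H x) => [[]|].
by rewrite IH; case: (lookup H x) => [[j A]|].
Qed.

Definition agrees (G H : ctx) : Prop :=
  forall x A, (x, A) \in G -> exists i, lookup H x = Some (i, A).

Lemma wf_agrees G : wf_ctx G -> agrees G G.
Proof.
rewrite /wf_ctx; elim: G => [|[y B] G IH] //= /andP[nin un] x A.
rewrite inE => /predU1P[[-> ->]|h].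
  by rewrite /= lookup_None // eqxx; exists 0.
by have [i li] := IH un _ _ h; exists i.+1; rewrite /= li.
Qed.

(** [lookup] prefers the rightmost declaration, so [xs] may shadow names of [H]; well-formedness of
    [G ++ xs] protects those of [G]. *)
Lemma agrees_cat G H xs : wf_ctx (G ++ xs) -> agrees G H -> agrees (G ++ xs) (H ++ xs).
Proof.
rewrite /wf_ctx /unzip1 map_cat cat_uniq => /and3P[_ dis uxs] ag x A.
rewrite lookup_cat mem_cat => /orP[h|/(wf_agrees uxs) [i ->]]; last by eexists.
rewrite lookup_None; first exact: ag.
by apply: contra dis => xin; apply/hasP; exists x => //; apply: (map_f fst h).
Qed.

Lemma den_lams D C (cv : C -> D) xs H M : den cv H (lams xs M) = den cv (H ++ xs) M.
Proof. by elim: xs H => [|[x A] xs IH] H /=; rewrite ?cats0 // IH cat_rcons. Qed.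

Lemma typeof_lams C xs H (M : term C) :
  typeof H (lams xs M) = omap (closeT xs) (typeof (H ++ xs) M).
Proof.
elim: xs H => [|[x A] xs IH] H /=; first by rewrite cats0; case: typeof.
by rewrite IH cat_rcons; case: typeof.
Qed.

Scheme safe_mind := Minimality for safe Sort Prop
  with asafe_mind := Minimality for asafe Sort Prop.

Definition uses_var D (s : jseq (move D)) (i : nat) : Prop :=
  exists n, mv s n = Some ([:: i], None).

(* Weakening is absorbed by quantifying over all contexts H agreeing with G. *)
Definition safe_den D (R : ty -> ty -> Prop) (G : ctx) (M : term void) (A : ty) : Prop :=
  wf_ctx G /\ forall H, agrees G H ->
  [/\ typeof H M = Some A,
      forall s, den (of_void D) H M s -> play (closeT H A) s /\ incremental (closeT H A) s
    & forall s i, den (of_void D) H M s -> i < size H -> uses_var s i ->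
        exists x C, [/\ (x, C) \in G, lookup H x = Some (i, C) & R A C]].

Lemma ord_le_ctx_in c G x (C : ty) : ord_le_ctx c G -> (x, C) \in G -> c <= ord C.
Proof. by move=> /allP h /h. Qed.

(** Serves both application rules. The function is only almost safe and says nothing about the
    orders of its variables, so the relation for the result is demanded of all of [G]: the side
    condition in one rule, trivial in the other. *)
Lemma app_safe_den D (R : ty -> ty -> Prop) G M N A B :
  safe_den D (fun _ _ => True) G M (Arr A B) ->
  safe_den D (fun A C => ord A <= ord C) G N A ->
  (forall x C, (x, C) \in G -> R B C) ->
  safe_den D R G (App M N) B.
Proof.
move=> [wf hM] [_ hN] hR; split=> // H ag.
have [tM dM vM] := hM H ag; have [tN dN vN] := hN H ag.
rewrite /= tM tN eqxx; split=> //.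
  apply: compose_incremental => // s i ds lt us.
  have [x [C [xin lC le]]] := vN s i ds lt us.
  by exists x, C; split=> //; apply: lookup_onth.
move=> s i ds lt us.
have [s' [[ds'|ds'] us']] := compose_vars ds lt us.
  have [x [C [xin lC _]]] := vM s' i ds' lt us'.
  by exists x, C; split=> //; apply: hR xin.
have [x [C [xin lC _]]] := vN s' i ds' lt us'.
by exists x, C; split=> //; apply: hR xin.
Qed.

Lemma var_safe_den D x A : safe_den D (fun A C => ord A <= ord C) [:: (x, A)] (Var x) A.
Proof.
split=> // H ag; have [i li] := ag x A (mem_head _ _).
have Hi := lookup_onth li; rewrite /= li; split=> // s.
  by move=> cs; split; [case: cs | apply: copycat_incremental Hi cs].
move=> j cs lt us; rewrite (copycat_vars Hi cs lt us).
by exists x, A; rewrite mem_head.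
Qed.

Lemma safe_den_incremental D G M A : safe G M A -> safe_den D (fun A C => ord A <= ord C) G M A.
Proof.
pose Q := @safe_den D; pose le A C := ord A <= ord C; pose tt (A C : ty) := True.
apply: (@safe_mind _ (Q le) (Q tt)) => {G M A} //.
- exact: var_safe_den.
- move=> G H M A _ [wf hM] sub wfH; split=> // H' ag.
  have ag' : agrees G H' by move=> x C h; apply: ag; apply: sub.
  have [tM dM vM] := hM H' ag'; split=> // s i ds lt us.
  by have [x [C [xin lC l]]] := vM s i ds lt us; exists x, C; split=> //; apply: sub.
- move=> G M N A B _ hM _ hN ok; apply: app_safe_den hM hN _ => x C.
  exact: ord_le_ctx_in.
(* The abstracted variables may have any order: they sit at positions from [size H] on, which the
   claim leaves unconstrained. The remaining ones are in [G], where the side condition applies. *)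
- move=> G xs M B _ _ [wf hM] ok; split.
    by move: wf; rewrite /wf_ctx /unzip1 map_cat cat_uniq => /and3P[].
  move=> H ag; have [tM dM vM] := hM _ (agrees_cat wf ag).
  rewrite den_lams typeof_lams tM -closeT_cat; split=> // s i ds lt us.
  have [|x [C [xin lC _]]] := vM s i ds _ us; first by rewrite size_cat ltn_addr.
  move: lC; rewrite lookup_cat; case lx: (lookup xs x) => [[j E]|] lC.
    by case: lC lt => <- _; rewrite ltnNge leq_addr.
  have xG : (x, C) \in G.
    move: xin; rewrite mem_cat => /orP[//|h].
    have wx : wf_ctx xs by move: wf; rewrite /wf_ctx /unzip1 map_cat cat_uniq => /and3P[].
    by have [k] := wf_agrees wx h; rewrite lx.
  by exists x, C; split=> //; apply: ord_le_ctx_in ok xG.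
- move=> G M A _ [wf hM]; split=> // H ag.
  have [tM dM vM] := hM H ag; split=> // s i ds lt us.
  by have [x [C [xin lC _]]] := vM s i ds lt us; exists x, C.
- by move=> G M N A B _ hM _ hN; apply: app_safe_den hM hN _.
Qed.

(** * Recovering the pointers *)

Lemma ord_args A i B : onth (args A) i = Some B -> ord B < ord A.
Proof.
elim: A i => [|A1 _ A2 IH] [|i] //=; first by case=> ->; rewrite leq_maxl.
by move=> /IH lt; apply: leq_trans lt (leq_maxr _ _).
Qed.

Lemma subty_rcons A r j : subty A (rcons r j) = obind (fun B => onth (args B) j) (subty A r).
Proof.
elim: r A => [|i r IH] A /=; first by case: onth.
by case: onth => //= B; apply: IH.
Qed.

(** Each step into an argument lowers the order, so the order of a type bounds the depth of its
    arena. *)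
Lemma subty_size A r B : subty A r = Some B -> size r + ord B <= ord A.
Proof.
elim: r A => [|i r IH] A /=; first by case=> ->.
by case e: (onth _ _) => [C|//] /IH le; have := ord_args e; lia.
Qed.

Lemma ordat_rcons A r j : subty A (rcons r j) <> None -> ordat A (rcons r j) < ordat A r.
Proof.
rewrite /ordat subty_rcons; case: (subty A r) => //= B.
by case e: (onth _ _) => [C|//] _; apply: ord_args e.
Qed.

Lemma play_root D A (s : jseq (move D)) n : play A s -> mv s n = Some ([::], None) -> n = 0.
Proof.
case=> js _ _ _ em; have := justified_ptr js em; case: n em => // n em.
by case=> [k [m [_ _ _ [_ _ [[i []]|[v []]]]]]] //; case: m.1.
Qed.

Lemma depth1_parent D A (m : move D) r : enables A m (r, None) -> size r = 1 -> m = ([::], None).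
Proof. by case: m => q o [/= -> _ [[i [->]]|[v []]]] //; rewrite size_rcons; case: q. Qed.

Section Prefix.
Variables (D : Type) (s1 s2 : jseq (move D)) (n : nat).
Hypothesis eq12 : forall i, i < n -> onth s1 i = onth s2 i.

Lemma view_prefix A pl k : play A s1 -> view pl s1 n k -> view pl s2 n k.
Proof.
move=> p1; have js : justified (@initial D) (enables A) s1 by case: p1.
have em i m : i < n -> mv s1 i = Some m -> mv s2 i = Some m by rewrite /mv => /eq12 ->.
have ep i m : i < n -> ptr s1 i = Some m -> ptr s2 i = Some m by rewrite /ptr => /eq12 ->.
have : n <= n by [].
move: {1 3 4}n => l le v; elim: v le => {l k}.
- move=> l lt le; apply: view_last; rewrite -onthTE -eq12 // onthTE //.
- by move=> l m k ml pm _ IH le; apply: (view_own (em _ _ le ml) pm); apply: IH; apply: ltnW.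
- by move=> l m j ml pm pj le; apply: (view_just (em _ _ le ml) pm); apply: ep.
- move=> l m j k ml pm pj _ IH le; apply: (view_other (em _ _ le ml) pm (ep _ _ le pj)).
  by apply: IH; apply: leq_trans (ltnW (justified_lt js pj)) (ltnW le).
Qed.

Lemma pending_prefix k : pending s1 n k -> pending s2 n k.
Proof.
move=> [lt q un]; split=> //; first by move: q; rewrite /holds /mv eq12.
by move=> j ltj; rewrite /holds /mv /ptr -eq12 //; apply: un.
Qed.
End Prefix.

(* At order 3 the noninitial O-questions have depth 2, so they point to depth 1. *)
Lemma oview_unique D A (s : jseq (move D)) n k k' r r' : play A s ->
  view false s n k -> view false s n k' ->
  mv s k = Some (r, None) -> mv s k' = Some (r', None) -> size r = 1 -> size r' = 1 -> k = k'.
Proof.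
move=> ps; elim/ltn_ind: n => -[|n] IH; first by move/view0.
have [js al _ _] := ps.
move=> /viewS [m em h] /viewS [m']; rewrite em => -[<-] {m'} h' ek ek' sr sr'.
have depth1 j (q : seq nat) : mv s j = Some (q, None) -> size q = 1 ->
    is_P (D := D) (q, None) /\ (j = n -> m = (q, None)).
  move=> ej sq; split; first by rewrite /is_P /= sq.
  by move=> e; move: em; rewrite -e ej => -[].
have [pr nr] := depth1 _ _ ek sr; have [pr' nr'] := depth1 _ _ ek' sr'.
case: h => [e|[[pm v]|[pm [j ej h]]]].
- move: ek; rewrite e em => -[em']; subst m.
  case: h' => [->//|[[pm']|[_ [j ej h']]]]; first by rewrite pm' in pr.
  have [q [mq en]] : exists q, mv s j = Some q /\ enables A q (r, None).
    have := justified_ptr js em; rewrite ej; case: (n) => [[]//|n'] [k1 [q [[<-] _ mq en]]].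
    by exists q.
  (* A depth-1 question is a P-move justified by the root, where the O-view stops; nothing else of
     depth 1 lies below it. *)
  have j0 : j = 0.
    by apply: (play_root ps); rewrite mq (depth1_parent en sr).
  rewrite j0 in h'; case: h' => [e'|/view0//]; rewrite e' in ek'.
  by have [e1 _] := justified_ptr js ek'; move: sr'; case: e1 => ->.
- have pf := pm; case: h' => [e|[[_ v']|[pm' _]]].
  + by rewrite (nr' e) pr' in pm.
  + exact: (IH n (leqnn _) v v' ek ek' sr sr').
  + by rewrite pf in pm'.
(* Here [j] justifies the P-move [m], so it holds an O-move, which cannot have depth 1. *)
- have ne : forall i q, i = j -> mv s i = Some (q, None) -> size q = 1 -> False.
    move=> i q e ei sq; subst i; have := justified_ptr js em.
    rewrite ej; case: (n) => [[]//|n'] [k1 [q' [[<-] _ mq /enables_is_P]]].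
    move: mq; rewrite ei => -[<-]; by rewrite pm /is_P /= sq.
  case: h' => [e|[[pm' _]|[_ [j' ej' h']]]]; last 1 first.
  + move: ej' h'; rewrite ej => -[<-] h'.
    case: h => [e|v]; first by case: (ne _ _ e ek sr).
    case: h' => [e|v']; first by case: (ne _ _ e ek' sr').
    by apply: (IH j _ v v' ek ek' sr sr'); apply: ltnW (justified_lt js ej).
  + subst k'; move: ek'; rewrite em => -[em']; subst m.
    case: h => [e|v]; first by case: (ne _ _ e ek sr).
    have := justified_ptr js em; rewrite ej.
    case: (n) => [[]//|n'] [k1 [q [[<-] _ mq en]]].
    have j0 : j = 0.
      by apply: (play_root ps); rewrite mq (depth1_parent en sr').
    by move: v; rewrite j0 => /view0.
  + by rewrite pm in pm'.
Qed.

(** Up to the current position the plays agree, hence so do their views and pending questions, and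
    each candidate justifier is eligible in both. [half] excludes that the second play points later
    than the first; symmetry gives equality. *)
Lemma incremental_plays_determined D A (s1 s2 : jseq (move D)) : ord A <= 3 ->
  play A s1 -> incremental A s1 -> play A s2 -> incremental A s2 ->
  moves s1 = moves s2 -> s1 = s2.
Proof.
move=> oA.
have mvE (s : jseq (move D)) i : mv s i = onth (moves s) i by rewrite /mv /moves /unzip1 onth_map.
have half (t1 t2 : jseq (move D)) i m k1 k2 : play A t1 -> incremental A t1 -> play A t2 ->
    (forall j, j < i -> onth t1 j = onth t2 j) ->
    mv t1 i = Some m -> mv t2 i = Some m -> ptr t1 i = Some k1 -> ptr t2 i = Some k2 ->
    k2 <= k1.
  move=> p1 i1 p2 e12 m1 m2 q1 q2; rewrite leqNgt; apply/negP => lt.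
  have [j1 _ v1 w1] := p1; have [j2 _ v2 w2] := p2.
  have e21 j : j < i -> onth t2 j = onth t1 j by move=> /e12.
  case qm: (is_question m); last first.
    have [_ max] := w1 _ _ _ m1 (negbT qm) q1; have [pe _] := w2 _ _ _ m2 (negbT qm) q2.
    by have := max _ (pending_prefix e21 pe); rewrite leqNgt lt.
  have i0 : 0 < i := leq_ltn_trans (leq0n _) (justified_lt j1 q1).
  have parent t k : justified (@initial D) (enables A) t -> mv t i = Some m -> ptr t i = Some k ->
      exists m', mv t k = Some m' /\ enables A m' m.
    move=> jt mt qt; have := justified_ptr jt mt; rewrite qt; case: (i) i0 => // i' _.
    by case=> k0 [m' [[<-] _ mk en]]; exists m'.
  have [n1 [mk1 en1]] := parent _ _ j1 m1 q1; have [n2 [mk2 en2]] := parent _ _ j2 m2 q2.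
  have mk2' : mv t1 k2 = Some n2 by move: mk2; rewrite /mv e12 // (justified_lt j2 q2).
  have vw2 : view (is_P m) t1 i k2 := view_prefix e21 p2 (v2 _ _ _ m2 q2).
  have vw1 := v1 _ _ _ m1 q1.
  case: n1 en1 mk1 => r1 o1 en1 mk1; case: n2 en2 mk2 mk2' => r2 o2 en2 mk2 mk2'.
  case: en1 (en2) => /= eo1 def [[l1 em]|[v ev]]; last by rewrite ev in qm.
  case=> /= eo2 _ [[l2 em2]|[v ev]]; last by rewrite ev in qm.
  subst o1 o2 m; case: em2 => /eqP; rewrite eqseq_rcons => /andP[/eqP er /eqP el]; subst r2 l2.
  rewrite /= in def.
  case pm: (is_P (D := D) (rcons r1 l1, None)) vw1 vw2 => vw1 vw2.
    (* Both candidates are occurrences of the same parent question, whose order exceeds that of the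
       move; the later one would break incrementality of [t1]. *)
    have sr : ~~ odd (size r1) by move: pm; rewrite /is_P /= size_rcons addbF.
    have := i1 _ _ _ _ _ m1 pm q1 vw2 lt mk2' sr.
    by rewrite /rank /= ltnS leqNgt ordat_rcons.
  (* The depth of an O-question is even, here positive and at most 3, hence 2. *)
  have sr : size r1 = 1.
    move: pm; rewrite /is_P /= size_rcons addbF /=.
    case eB: (subty A (rcons r1 l1)) def => [B|//] _; have := subty_size eB.
    rewrite size_rcons; case: (size r1) => [|[|[|?]]] //=; lia.
  by move: lt; rewrite (oview_unique p1 vw1 vw2 mk1 mk2' sr sr) ltnn.
move=> p1 i1 p2 i2 em; apply: eq_from_onth => i; elim/ltn_ind: i => i IH.
have := mvE s1 i; rewrite em -mvE => emi.
case mi: (mv s2 i) => [m|]; last first.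
  by move: emi mi; rewrite /mv; case: (onth s1 i) => [[]|]; case: (onth s2 i) => [[]|].
rewrite mi in emi; rewrite (mv_onth mi) (mv_onth emi); congr (Some (_, _)).
have [j1 _ _ _] := p1; have [j2 _ _ _] := p2.
have h1 := justified_ptr j1 emi; have h2 := justified_ptr j2 mi.
have IH' j : j < i -> onth s2 j = onth s1 j by move=> /IH.
case: i IH IH' mi emi h1 h2 => [|i] IH IH' mi emi; first by case=> _ -> [_ ->].
move=> [k1 [m1 [e1 _ _ _]]] [k2 [m2 [e2 _ _ _]]]; rewrite e1 e2; congr Some; apply/eqP.
rewrite eqn_leq (half _ _ _ _ _ _ p2 i2 p1 IH' mi emi e2 e1).
by rewrite (half _ _ _ _ _ _ p1 i1 p2 IH emi mi e1 e2).
Qed.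

(** * The order-4 example *)

(** The example contains no answers, so its plays are coded by bare addresses and verified by the
    boolean checker [question_play]. *)
Definition questions D (w : jseq (seq nat)) : jseq (move D) := [seq ((x.1, None), x.2) | x <- w].

Definition justified_at (A : ty) (w : jseq (seq nat)) (i : nat) (r : seq nat) (q : option nat) : bool :=
  if i is 0 then (r == [::]) && (q == None) else
  if q is Some k then
    [&& k < i, 0 < size r, subty A r != None & mv w k == Some (take (size r).-1 r)]
  else false.

Fixpoint view_list (fuel : nat) (pl : bool) (w : jseq (seq nat)) (n : nat) : seq nat :=
  if (fuel, n) is (f.+1, m.+1) then
    if onth w m is Some (r, q) then
      m :: (if odd (size r) == pl then view_list f pl w m
            else if q is Some j then j :: view_list f pl w j else [::])
    else [::]
  else [::].

Definition question_play (A : ty) (w : jseq (seq nat)) : bool :=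
  all (fun i => if onth w i is Some (r, q) then
         [&& justified_at A w i r q, odd (size r) == odd i &
           (if q is Some k then k \in view_list i (odd (size r)) w i else true)]
       else true) (iota 0 (size w)).

Lemma onth_questions D w i : onth (questions D w) i = omap (fun x => ((x.1, None), x.2)) (onth w i).
Proof. exact: onth_map. Qed.

Lemma view_listP D f pl w n k : k \in view_list f pl w n -> view pl (questions D w) n k.
Proof.
elim: f n => // f IH [|n] //=; case e: (onth w n) => [[r q]|] //.
have em : mv (questions D w) n = Some (r, None) by rewrite /mv onth_questions e.
have eq : ptr (questions D w) n = q by rewrite /ptr onth_questions e.
have pr : is_P (D := D) (r, None) = odd (size r) by rewrite /is_P addbF.
rewrite inE => /predU1P[->|]; first by apply: view_last; rewrite size_map -onthTE e.
case: eqP => [o /IH|o]; first by apply: view_own em _; rewrite pr.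
have pr' : is_P (D := D) (r, None) = ~~ pl by rewrite pr; move: o; case: (pl); case: odd.
case: q e eq => // j e eq; rewrite inE => /predU1P[->|/IH]; first exact: view_just em pr' eq.
exact: view_other em pr' eq.
Qed.

(** The renaming [g] lets one check serve both plays and tagged interactions. *)
Lemma question_justified (X : Type) (g : seq nat -> X) ini en A w :
  question_play A w -> ini (g [::]) ->
  (forall r r' l, r' = rcons r l -> subty A r' <> None -> en (g r) (g r')) ->
  justified ini en [seq (g x.1, x.2) | x <- w].
Proof.
move=> /allP ok gini gen i m q; rewrite onth_map; case e: (onth w i) => [[r q']|] //= [<- <-].
have lt : i < size w by rewrite -onthTE e.
have := ok i; rewrite mem_iota lt e => /(_ isT) /and3P[+ _ _].
case: i {e lt} => [/andP[/eqP-> /eqP->]|i] //.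
case: q' => [k|] // /and4P[lt sr /eqP sub /eqP ek].
exists k, (g (take (size r).-1 r)); split=> //.
  by move: ek; rewrite /mv onth_map; case: (onth w k) => //= x [->].
case/lastP: r sr sub {ek} => // r l _ sub; rewrite size_rcons /=.
by have -> : take (size r) (rcons r l) = r; [rewrite -cats1 take_size_cat | apply: gen sub].
Qed.

Lemma question_playP D A w : question_play A w -> play A (questions D w).
Proof.
move=> ok; split.
- apply: (question_justified (g := fun r => (r, None)) ok) => // r r' l -> sub.
  by split=> //; left; exists l.
- move=> i m; rewrite /mv onth_questions; case e: (onth w i) => [[r q]|] //= [<-].
  have lt : i < size w by rewrite -onthTE e.
  have := allP ok i; rewrite mem_iota lt e => /(_ isT) /and3P[_ /eqP <- _].
  by rewrite /is_P addbF.
- move=> i m k; rewrite /mv /ptr onth_questions; case e: (onth w i) => [[r q]|] //= [<-] eq.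
  have lt : i < size w by rewrite -onthTE e.
  have := allP ok i; rewrite mem_iota lt e eq => /(_ isT) /and3P[_ _ /view_listP].
  by rewrite /is_P addbF.
- move=> i m k; rewrite /mv onth_questions; case e: (onth w i) => [[r q]|] //= [<-].
  by [].
Qed.

Section Order4.
Variables (D : Type) (a : D).
Let oo := Arr Base Base.
Let G : ctx := [:: (0, Arr (Arr oo Base) Base)].
Let G' : ctx := rcons G (1, oo).
Let M : term unit := App (Var 0) (Lam 1 oo (App (Var 1) (Con tt))).

(** The start of [phi a]: the opening question, then the initial question of phi, at address 1
    because psi has address 0. *)
Let call : jseq (seq nat) := [:: ([::], None); ([:: 1], Some 0)].

Lemma order4_argument : den (fun=> a) G (Lam 1 oo (App (Var 1) (Con tt))) (questions D call).
Proof.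
split; first exact: question_playP.
exists [seq ((true, (x.1, None)), x.2) | x <- call]; split.
- apply: (@question_justified _ (fun r => (true, (r, None))) _ _ (closeT G' oo)) => // r r' l -> sub.
  by split=> //; left; exists l.
- split; first exact: (@question_playP D (closeT G' oo) call).
  by case=> [|[|[|n]]] //.
(* A thread for the constant would open at address 2, which [call] does not reach. *)
- by case=> [|[|b]]; rewrite /mv /initialA //= onth0n.
- by [].
Qed.

(* The addresses starting with 1 belong to the hidden argument of psi, which is
   called twice and copies each call of phi to the outside. *)
Let inter (k : nat) : jseq (seq nat) :=
  [:: ([::], None); ([:: 0], Some 0); ([:: 0; 0], Some 1); ([:: 1], Some 0);
      ([:: 1; 0], Some 3); ([:: 0; 0; 0], Some 2); ([:: 0; 0], Some 1); ([:: 1], Some 0);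
      ([:: 1; 0], Some 7); ([:: 0; 0; 0], Some 6); ([:: 0; 0; 0; 0], Some k)].

Let visible_play (k : nat) : jseq (seq nat) :=
  [:: ([::], None); ([:: 0], Some 0); ([:: 0; 0], Some 1); ([:: 0; 0; 0], Some 2);
      ([:: 0; 0], Some 1); ([:: 0; 0; 0], Some 4); ([:: 0; 0; 0; 0], Some k)].

(** Positions 5 and 9 of the interaction hold the two calls of phi; they become 3 and 5 when the
    hidden moves at 3, 4, 7 and 8 are erased. *)
Lemma order4_play k k' : (k, k') = (5, 3) \/ (k, k') = (9, 5) ->
  den (fun=> a) G M (questions D (visible_play k')).
Proof.
move=> kk; split; first by case: kk => -[_ ->]; apply: question_playP.
exists [seq ((true, (x.1, None)), x.2) | x <- inter k]; split.
- apply: (@question_justified _ (fun r => (true, (r, None))) _ _ (closeT G (Arr (Arr oo Base) Base))) => //.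
    by case: kk => -[-> _].
  by move=> r r' l -> sub; split=> //; left; exists l.
- have -> : projM [seq ((true, (x.1, None)), x.2) | x <- inter k] = questions D (inter k).
    by case: kk => -[-> _].
  split; first by case: kk => -[-> _]; apply: question_playP.
  by case: kk => -[-> _]; do 12!case=> //.
(* The hidden argument is opened at 3 and at 7, and both threads are the play [call]. *)
- move=> b mb; have eb : b = 3 \/ b = 7.
    move: mb; rewrite /mv /initialA; do 11!(case: b => [|b]; first by auto).
    by rewrite /= onth0n.
  by case: kk eb => -[-> _] [] ->; refine order4_argument.
- by case: kk => -[-> ->].
Qed.

(** The abstraction has order 2 and its only free variable psi has order 3. *)
Lemma order4_safe : safe G M Base.
Proof.
have sv A x H : (x, A) \in H -> wf_ctx H -> safe (C := unit) H (Var x) A.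
  move=> xH wf; apply: (safe_wk (safe_var _ x A)) => // y; rewrite inE => /eqP->//.
apply: (@safe_app _ _ _ _ (Arr oo Base)) => //; first by apply: asafe_delta; apply: sv.
apply: (@safe_abs _ G [:: (1, oo)] _ Base) => //.
apply: (@asafe_app _ _ _ _ Base); first by apply: asafe_delta; apply: sv.
by apply: (safe_wk (safe_const _)).
Qed.
End Order4.

Theorem mainTheorem8 (D : Type) (HD : inhabited D) :
  (* (a) *)
  (forall (G : ctx) (M : term void) (T : ty),
     safe G M T -> ord (closeT G T) <= 3 ->
     forall s1 s2 : jseq (move D),
       den (of_void D) G M s1 -> den (of_void D) G M s2 ->
       moves s1 = moves s2 -> s1 = s2)
  /\
  (* (b), where the only constant tt : unit denotes a, psi is the variable 0 and
     phi is the variable 1 *)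
  (forall a : D,
     let oo := Arr Base Base in
     let G : ctx := [:: (0, Arr (Arr oo Base) Base)] in
     let M : term unit := App (Var 0) (Lam 1 oo (App (Var 1) (Con tt))) in
     let q (i : nat) : move D := (nseq i 0, None) in
     let qs := [:: q 0; q 1; q 2; q 3; q 2; q 3; q 4] in
     [/\ ord (closeT G Base) = 4,
         safe G M Base
       & exists s1 s2 : jseq (move D),
         [/\ den (fun=> a) G M s1 /\ den (fun=> a) G M s2,
             moves s1 = qs /\ moves s2 = qs,
             ptr s1 6 = Some 3 /\ ptr s2 6 = Some 5
           & s1 <> s2]]).
Proof.
split=> [G M T sM oT s1 s2 d1 d2|a oo G M q qs].
  have [wf h] := safe_den_incremental D sM.
  have [_ dM _] := h _ (wf_agrees wf).
  have [p1 i1] := dM _ d1; have [p2 i2] := dM _ d2.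
  exact: incremental_plays_determined oT p1 i1 p2 i2.
split=> //; first exact: order4_safe.
have d1 := @order4_play D a 5 3 (or_introl erefl); have d2 := @order4_play D a 9 5 (or_intror erefl).
do 2!eexists; split; [by split; [exact: d1 | exact: d2] | by [] | by [] |].
by [].
Qed.
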